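(* Let $(R,\Lambda)$ be a form ring (with respect to a fixed $\lambda$), let $k$ be a positive integer with $kR=R$, and let $[\alpha(X)]\in \mathrm{NK}_1\mathrm{GQ}^{\lambda}(R,\Lambda)$ be the class of a matrix $\alpha(X)=\begin{pmatrix} A(X)&B(X)\\ C(X)&D(X)\end{pmatrix}\in \mathrm{GQ}^{\lambda}(2r,R[X],\Lambda[X])$ (in $r\times r$ blocks) with $A(X)\in \mathrm{GL}_r(R[X])$ for some $r\in\mathbb{N}$. Then $[\alpha(X)]$ has no $k$-torsion; that is, if $[\alpha(X)]^k=[\mathrm{I}]$ then $[\alpha(X)]=[\mathrm{I}]$.
   Context: Form rings: $R$ is an associative ring with $1$, with an involution $a\mapsto\overline a$ (an additive anti-automorphism with $\overline{\overline a}=a$), and $\lambda$ is a fixed element of the center of $R$ with $\lambda\overline\lambda=1$. Put $\Lambda_{\max}=\{a\in R: a=-\lambda\overline a\}$ and $\Lambda_{\min}=\{a-\lambda\overline a: a\in R\}$. A $\lambda$-form parameter is an additive subgroup $\Lambda$ with $\Lambda_{\min}\subseteq\Lambda\subseteq\Lambda_{\max}$ and $\overline x\Lambda x\subseteq\Lambda$ for all $x\in R$; the pair $(R,\Lambda)$ is called a form ring. Put $\overline\Lambda=\{\overline a:a\in\Lambda\}$. The involution extends to $R[X]$ by $\overline X=X$, and $(R[X],\Lambda[X])$ is again a form ring (with the same $\lambda$). Matrices: for $a=(a_{ij})$ over $R$, $a^*=(\overline{a_{ji}})$. A matrix $\gamma\in M_n(R)$ is $\Lambda$-Hermitian if $\gamma=-\lambda\gamma^*$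 and its diagonal entries lie in $\Lambda$; $\beta\in M_n(R)$ is $\overline\Lambda$-Hermitian if $\beta=-\overline\lambda\beta^*$ and its diagonal entries lie in $\overline\Lambda$. Groups: $\mathrm{GQ}^{\lambda}(2n,R,\Lambda)$ is the group of all $\sigma=\begin{pmatrix}a&b\\c&d\end{pmatrix}\in\mathrm{GL}_{2n}(R)$ ($n\times n$ blocks) with $\sigma^*\psi_n\sigma=\psi_n$, where $\psi_n=\begin{pmatrix}0&\mathrm{I}_n\\ \lambda\mathrm{I}_n&0\end{pmatrix}$, such that the diagonal entries of $a^*c$ and $b^*d$ lie in $\Lambda$. $\mathrm{EQ}^{\lambda}(2n,R,\Lambda)$ is the subgroup generated by the matrices $\begin{pmatrix}\varepsilon&0\\0&(\varepsilon^* )^{-1}\end{pmatrix}$ with $\varepsilon$ in the elementary group $\mathrm{E}_n(R)$ (generated by $\mathrm{I}_n+xe_{ij}$, $x\in R$, $i\ne j$), $\begin{pmatrix}\mathrm{I}_n&\beta\\0&\mathrm{I}_n\end{pmatrix}$ with $\beta$ $\overline\Lambda$-Hermitian, and $\begin{pmatrix}\mathrm{I}_n&0\\ \gamma&\mathrm{I}_n\end{pmatrix}$ with $\gamma$ $\Lambda$-Hermitian. Stabilization $\mathrm{GQ}^{\lambda}(2n,R,\Lambda)\to\mathrm{GQ}^{\lambda}(2n+2,R,\Lambda)$ replaces $a,d$ by $\begin{pmatrix}a&0\\0&1\end{pmatrix},\begin{pmatrix}d&0\\0&1\end{pmatrix}$ and $b,c$ by $\begin{pmatrix}b&0\\0&0\end{pmatrix},\begin{pmatrix}c&0\\0&0\end{pmatrix}$.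 $\mathrm{GQ}^{\lambda}(R,\Lambda)$ and $\mathrm{EQ}^{\lambda}(R,\Lambda)$ denote the unions over $n$; $\mathrm{EQ}^{\lambda}(R,\Lambda)$ is the commutator subgroup of $\mathrm{GQ}^{\lambda}(R,\Lambda)$, and $\mathrm{K}_1\mathrm{GQ}^{\lambda}(R,\Lambda)=\mathrm{GQ}^{\lambda}(R,\Lambda)/\mathrm{EQ}^{\lambda}(R,\Lambda)$. The class of $\alpha$ is written $[\alpha]$. $\mathrm{NK}_1\mathrm{GQ}^{\lambda}(R,\Lambda)$ is the kernel of the homomorphism $\mathrm{K}_1\mathrm{GQ}^{\lambda}(R[X],\Lambda[X])\to\mathrm{K}_1\mathrm{GQ}^{\lambda}(R,\Lambda)$ induced by $X\mapsto0$. *)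

(* Defs.v *)
From mathcomp Require Import all_boot all_order all_algebra.
From mathcomp Require Import boolp classical_sets.
Set Implicit Arguments.
Unset Strict Implicit.
Unset Printing Implicit Defensive.
Import GRing.Theory.
Local Open Scope classical_set_scope.
Local Open Scope ring_scope.

Record form_ring (R : nzRingType) := FormRing {
  bar : R -> R;
  lam : R;
  Lam : set R;
  barD : forall x y, bar (x + y) = bar x + bar y;
  barM : forall x y, bar (x * y) = bar y * bar x;
  barK : forall x, bar (bar x) = x;
  lam_central : forall x, lam * x = x * lam;
  lam_bar : lam * bar lam = 1;
  Lam0 : Lam 0;
  LamB : forall x y, Lam x -> Lam y -> Lam (x - y);
  Lam_min : forall a, Lam (a - lam * bar a);
  Lam_max : forall a, Lam a -> a = - (lam * bar a);
  Lam_conj : forall x a, Lam a -> Lam (bar x * a * x)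
}.

Section PolyFormRing.
Variables (R : nzRingType) (F : form_ring R).

Definition bar_poly (p : {poly R}) : {poly R} := map_poly (bar F) p.
Definition Lam_poly : set {poly R} := [set p | forall i, Lam F p`_i].

Lemma bar0 : bar F 0 = 0.
Proof. by apply: (addrI (bar F 0)); rewrite -barD !addr0. Qed.

Lemma barN x : bar F (- x) = - bar F x.
Proof. by apply: (addrI (bar F x)); rewrite -barD !subrr bar0. Qed.

Lemma bar_sum (I : Type) (s : seq I) (P : pred I) (f : I -> R) :
  bar F (\sum_(i <- s | P i) f i) = \sum_(i <- s | P i) bar F (f i).
Proof. exact: (big_morph _ (barD F) bar0). Qed.

Lemma bar1 : bar F 1 = 1.
Proof. by rewrite -[LHS]mulr1 -{2}[1](barK F) -barM mulr1 barK. Qed.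

Lemma coef_bar p i : (bar_poly p)`_i = bar F p`_i.
Proof. by rewrite coef_map_id0 ?bar0. Qed.

Lemma bar_polyX : bar_poly 'X = 'X.
Proof. by apply/polyP => i; rewrite coef_bar !coefX; case: eqP; rewrite ?bar1 ?bar0. Qed.

Lemma bar_polyC c : bar_poly c%:P = (bar F c)%:P.
Proof. by apply/polyP => i; rewrite coef_bar !coefC; case: eqP; rewrite ?bar0. Qed.

Lemma bar_polyD p q : bar_poly (p + q) = bar_poly p + bar_poly q.
Proof. by apply/polyP => i; rewrite !(coef_bar, coefD) barD. Qed.

Lemma bar_polyM p q : bar_poly (p * q) = bar_poly q * bar_poly p.
Proof.
apply/polyP => i; rewrite coef_bar coefM coefMr bar_sum.
by apply: eq_bigr => j _; rewrite barM !coef_bar.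
Qed.

Lemma bar_polyK p : bar_poly (bar_poly p) = p.
Proof. by apply/polyP => i; rewrite !coef_bar barK. Qed.

Lemma lam_poly_central p : (lam F)%:P * p = p * (lam F)%:P.
Proof. by apply/polyP => i; rewrite coefCM coefMC lam_central. Qed.

Lemma lam_poly_bar : (lam F)%:P * bar_poly (lam F)%:P = 1.
Proof. by rewrite bar_polyC -polyCM lam_bar. Qed.

Lemma Lam_poly0 : Lam_poly 0.
Proof. by move=> i; rewrite coef0; apply: Lam0. Qed.

Lemma Lam_polyB p q : Lam_poly p -> Lam_poly q -> Lam_poly (p - q).
Proof. by move=> hp hq i; rewrite coefB; apply: LamB. Qed.

Lemma Lam_polyD p q : Lam_poly p -> Lam_poly q -> Lam_poly (p + q).
Proof.
move=> hp hq; rewrite -[q]opprK -[- q]sub0r; apply: Lam_polyB => //.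
by apply: Lam_polyB => //; apply: Lam_poly0.
Qed.

Lemma Lam_poly_min p : Lam_poly (p - (lam F)%:P * bar_poly p).
Proof. by move=> i; rewrite coefB coefCM coef_bar; apply: Lam_min. Qed.

Lemma Lam_poly_max p : Lam_poly p -> p = - ((lam F)%:P * bar_poly p).
Proof.
by move=> hp; apply/polyP => i; rewrite coefN coefCM coef_bar; apply: Lam_max.
Qed.

Lemma Lam_poly_conj q p : Lam_poly p -> Lam_poly (bar_poly q * p * q).
Proof.
move=> hp; elim/poly_ind: q => [|q c IH].
  by rewrite mulr0; apply: Lam_poly0.
set u := q * 'X; set v := c%:P.
have hu : Lam_poly (bar_poly u * p * u).
  have -> : bar_poly u * p * u = bar_poly q * p * q * 'X * 'X.
    rewrite /u bar_polyM bar_polyX -(commr_polyX (bar_poly q)) -!mulrA.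
    by congr (_ * _); rewrite -(commr_polyX (p * (q * 'X))) -!mulrA.
  move=> i; rewrite coefMX; case: eqP => _; first exact: Lam0.
  by rewrite coefMX; case: eqP => _; [exact: Lam0|exact: IH].
have hv : Lam_poly (bar_poly v * p * v).
  by rewrite /v bar_polyC => i; rewrite coefMC coefCM; apply: Lam_conj.
have hw : Lam_poly (bar_poly u * p * v + bar_poly v * p * u).
  have -> : bar_poly v * p * u =
    - ((lam F)%:P * bar_poly (bar_poly u * p * v)).
    rewrite 2!bar_polyM (bar_polyK u) {1}(Lam_poly_max hp) mulrN mulNr; congr (- _).
    by rewrite !mulrA (lam_poly_central (bar_poly v)).
  exact: Lam_poly_min.
have -> : bar_poly (u + v) * p * (u + v) =
    (bar_poly u * p * u + bar_poly v * p * v)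
    + (bar_poly u * p * v + bar_poly v * p * u).
  by rewrite bar_polyD !mulrDl !mulrDr [bar_poly v * p * u + _]addrC addrACA.
by apply: Lam_polyD hw; apply: Lam_polyD.
Qed.

(* (R[X], Lambda[X]): the involution acts on coefficients, hence fixes X. *)
Definition poly_form_ring : form_ring {poly R} :=
  FormRing bar_polyD bar_polyM bar_polyK lam_poly_central lam_poly_bar
    Lam_poly0 Lam_polyB Lam_poly_min Lam_poly_max Lam_poly_conj.

End PolyFormRing.

Section Matrices.
Variable R : nzRingType.

Definition inverse_mx n (a b : 'M[R]_n) := a *m b = 1%:M /\ b *m a = 1%:M.

(* [unitmx] is only available over commutative rings. *)
Definition GL n : set 'M[R]_n := [set a | exists b, inverse_mx a b].

Inductive generated n (S : set 'M[R]_n) : set 'M[R]_n :=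
| generated1 : generated S 1%:M
| generated_in a : S a -> generated S a
| generatedM a b : generated S a -> generated S b -> generated S (a *m b)
| generatedV a b : generated S a -> inverse_mx a b -> generated S b.

Definition elementary n : set 'M[R]_n :=
  generated [set a | exists i j x, i != j /\ a = 1%:M + x *: delta_mx i j].

End Matrices.

Section QuadraticGroups.
Variables (R : nzRingType) (F : form_ring R).

Definition star m n (a : 'M[R]_(m, n)) : 'M[R]_(n, m) := map_mx (bar F) a^T.

Definition Lam_hermitian n : set 'M[R]_n :=
  [set c | c = - (lam F *: star c) /\ forall i, Lam F (c i i)].

Definition Lambar_hermitian n : set 'M[R]_n :=
  [set b | b = - (bar F (lam F) *: star b) /\ forall i, (bar F @` Lam F) (b i i)].

Definition psi n : 'M[R]_(n + n) := block_mx 0 1%:M (lam F)%:M 0.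

Definition GQ n : set 'M[R]_(n + n) :=
  [set s | [/\ GL s, star s *m psi n *m s = psi n,
    forall i, Lam F ((star (ulsubmx s) *m dlsubmx s) i i) &
    forall i, Lam F ((star (ursubmx s) *m drsubmx s) i i)]].

Inductive EQ_generator n : set 'M[R]_(n + n) :=
| EQ_diag e e' : elementary e -> inverse_mx (star e) e' ->
    EQ_generator (block_mx e 0 0 e')
| EQ_upper b : Lambar_hermitian b -> EQ_generator (block_mx 1%:M b 0 1%:M)
| EQ_lower c : Lam_hermitian c -> EQ_generator (block_mx 1%:M 0 c 1%:M).

Definition EQ n : set 'M[R]_(n + n) := generated (@EQ_generator n).

End QuadraticGroups.

Section Stable.
Variable R : nzRingType.

(* The union over n is formed inside the infinite matrices with 2 x 2 blocks
   indexed by nat: [inl i] (resp. [inr i]) is the i-th index of the first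
   (resp. second) half.  [stable s] is s extended by the identity; by
   [stable_stabilize] and [stable_inj] the union is along stabilization. *)
Definition stmx := (nat + nat -> nat + nat -> R)%type.

Definition trunc n (x : nat + nat) : option 'I_(n + n) :=
  match x with
  | inl i => omap (lshift n) (insub i)
  | inr i => omap (@rshift n n) (insub i)
  end.

Definition stable n (s : 'M[R]_(n + n)) : stmx := fun x y =>
  match trunc n x, trunc n y with
  | Some i, Some j => s i j
  | _, _ => (x == y)%:R
  end.

Definition stabilize n (s : 'M[R]_(n + n)) : 'M[R]_((n + 1) + (n + 1)) :=
  block_mx (block_mx (ulsubmx s) 0 0 1%:M) (block_mx (ursubmx s) 0 0 0)
           (block_mx (dlsubmx s) 0 0 0) (block_mx (drsubmx s) 0 0 1%:M).

Lemma stable_inj n : injective (@stable n).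
Proof.
move=> s t e; apply/matrixP => i j.
pose u (i : 'I_(n + n)) : nat + nat :=
  match split i with inl k => inl (val k) | inr k => inr (val k) end.
have uK k : trunc n (u k) = Some k.
  by rewrite /u -{2}(splitK k); case: (split k) => l; rewrite /trunc valK.
by move: (congr1 (fun f => f (u i) (u j)) e); rewrite /stable !uK.
Qed.

Variant ord_succ_spec n (k : nat) : option 'I_n -> option 'I_(n + 1) -> Type :=
| OrdLt i of k = val i : ord_succ_spec k (Some i) (Some (lshift 1 i))
| OrdEq of k = n : ord_succ_spec k None (Some (rshift n ord0))
| OrdGt of (n < k)%N : ord_succ_spec k None None.

Lemma ord_succP n k : @ord_succ_spec n k (insub k) (insub k).
Proof.
case: (ltngtP k n) => h.
- rewrite (insubT (fun k => k < n)%N h).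
  have -> : insub k = Some (lshift 1 (Ordinal h)) :> option 'I_(n + 1).
    exact: (valK (lshift 1 (Ordinal h))).
  exact: OrdLt.
- by rewrite !insubF; [exact: OrdGt | rewrite addn1 ltnS leqNgt h | rewrite ltnNge ltnW].
- rewrite insubF ?h ?ltnn //.
  have -> : insub n = Some (rshift n ord0) :> option 'I_(n + 1).
    by rewrite -(valK (rshift n ord0)) /= addn0.
  exact: OrdEq.
Qed.

Lemma stable_stabilize n (s : 'M[R]_(n + n)) : stable (stabilize s) = stable s.
Proof.
have inlE (a b : nat) : (inl a == inl b :> nat + nat) = (a == b) by [].
have inrE (a b : nat) : (inr a == inr b :> nat + nat) = (a == b) by [].
apply/funext => x; apply/funext => y; rewrite /stable.
case: x => k; case: y => l; rewrite /trunc.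
all: case: (ord_succP n k) => [i ->|->|hk].
all: case: (ord_succP n l) => [j ->|->|hl] //=.
all: rewrite ?(block_mxEul, block_mxEur, block_mxEdl, block_mxEdr).
all: rewrite ?mxE ?eqxx // ?(inlE, inrE).
all: by rewrite ?(gtn_eqF (ltn_ord _)) ?(ltn_eqF (ltn_ord _)).
Qed.

End Stable.

Section K1.

(* Product of two subsets of the stable group; any two stable elements are
   represented at a common level n. *)
Definition set_mulmx (R : nzRingType) (A B : set (stmx R)) : set (stmx R) :=
  [set z | exists n (s t : 'M[R]_(n + n)),
    [/\ A (stable s), B (stable t) & z = stable (s *m t)]].

Variables (R : nzRingType) (F : form_ring R).

Definition GQst : set (stmx R) := \bigcup_n (@stable R n @` GQ F (n := n)).
Definition EQst : set (stmx R) := \bigcup_n (@stable R n @` EQ F (n := n)).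

(* Elements of K1GQ = GQ / EQ are cosets; since EQ is normal in GQ, the group
   law on cosets is the product of subsets. *)
Definition K1class n (s : 'M[R]_(n + n)) : set (stmx R) :=
  set_mulmx [set stable s] EQst.

Definition K1GQ : set (set (stmx R)) :=
  [set set_mulmx [set g] EQst | g in GQst].

Definition K1one : set (stmx R) := K1class (1%:M : 'M[R]_(0 + 0)).

Definition K1mul (x y : set (stmx R)) : set (stmx R) := set_mulmx x y.

Definition K1exp (x : set (stmx R)) (k : nat) : set (stmx R) :=
  iter k (K1mul x) K1one.

End K1.

Section NK1.
Variables (R : nzRingType) (F : form_ring R).

Definition stable_eval0 (s : stmx {poly R}) : stmx R := fun x y => (s x y).[0].

Lemma stable_eval0E n (s : 'M[{poly R}]_(n + n)) :
  stable_eval0 (stable s) = stable (map_mx (horner^~ 0) s).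
Proof.
apply/funext => x; apply/funext => y; rewrite /stable_eval0 /stable.
case: (trunc n x) => [i|]; case: (trunc n y) => [j|]; rewrite ?mxE //.
all: by case: eqP => _; rewrite -?polyC1 -?polyC0 hornerC.
Qed.

Definition K1eval0 (x : set (stmx {poly R})) : set (stmx R) :=
  set_mulmx (stable_eval0 @` x) (EQst F).

Definition NK1GQ : set (set (stmx {poly R})) :=
  [set x | K1GQ (poly_form_ring F) x /\ K1eval0 x = K1one F].

End NK1.

(* Main.v *)
From HB Require Import structures.
Require Import Defs.
From mathcomp Require Import all_boot all_order all_algebra.
From mathcomp Require Import boolp classical_sets.
From mathcomp Require Import mxtens ring.
Set Implicit Arguments.
Unset Strict Implicit.
Unset Printing Implicit Defensive.
Import GRing.Theory.
Local Open Scope classical_set_scope.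
Local Open Scope ring_scope.

(** Since [A] is invertible, [alpha] is a product of a lower unipotent matrix, the
hyperbolic matrix [H(A) = diag(A, A^{*-1})] and an upper unipotent matrix, so
[[alpha] = [H(A)]].  After dividing by [A(0)], Higman's linearization reduces to
[A = 1 + N X] with [N] over [R], and invertibility of [A] makes [N] nilpotent.
As [k] is invertible, truncating the binomial series gives a polynomial [g] with
[g(N)^k = 1 + N X] exactly.  Let [P] be a companion matrix with
[det(1 + t P) = g(t)].  Substituting [P] for [X] is a ring homomorphism from [R[X]] to
matrices over [R[X]]; because [P] is self-adjoint for a unimodular symmetric
Hankel form [J], it induces a transfer map on quadratic groups which preserves
[EQ].  It maps [1 + N X] to [1 + N (x) P], which is [g(N)] up to elementary
matrices.  Hence [[H(1 + N X)]^k = 1] implies [[H(g(N))]^k = 1], and the latter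
class is [[H(g(N)^k)] = [H(1 + N X)]]. *)

(** * Block sums, inverses and elementary matrices *)

Definition dsum (R : nzRingType) n m (a : 'M[R]_n) (b : 'M[R]_m) : 'M[R]_(n + m) :=
  block_mx a 0 0 b.

(** Stabilization by [m] steps at once: both halves grow at their ends, so the infinite matrix
    [stable s] does not change. *)
Definition embed (R : nzRingType) m n (s : 'M[R]_(n + n)) : 'M[R]_((n + m) + (n + m)) :=
  block_mx (dsum (ulsubmx s) 1%:M) (dsum (ursubmx s) 0)
           (dsum (dlsubmx s) 0) (dsum (drsubmx s) 1%:M).

Section Generation.
Variable R : nzRingType.

Lemma inverse_mx1 n : inverse_mx (1%:M : 'M[R]_n) 1%:M.
Proof. by split; rewrite mulmx1. Qed.

Lemma inverse_mx_sym n (a b : 'M[R]_n) : inverse_mx a b -> inverse_mx b a.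
Proof. by case. Qed.

Lemma inverse_mx_uniq n (a b c : 'M[R]_n) : a *m b = 1%:M -> c *m a = 1%:M -> b = c.
Proof. by move=> ab ca; rewrite -[b]mul1mx -ca -mulmxA ab mulmx1. Qed.

Lemma inverse_mxM n (a a' b b' : 'M[R]_n) :
  inverse_mx a a' -> inverse_mx b b' -> inverse_mx (a *m b) (b' *m a').
Proof.
move=> [aa' a'a] [bb' b'b]; split.
  by rewrite mulmxA -(mulmxA a) bb' mulmx1.
by rewrite mulmxA -(mulmxA b') a'a mulmx1.
Qed.

Lemma inverse_mxX n (a a' : 'M[R]_n) k : inverse_mx a a' -> inverse_mx (a ^+ k) (a' ^+ k).
Proof.
move=> h; elim: k => [|k IH]; first exact: inverse_mx1.
by rewrite exprS exprSr; apply: inverse_mxM.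
Qed.

(** Over a noncommutative ring both sides must be checked: [a ^+ k *m b'] is a right inverse of [a]
    and [b' *m a ^+ k] a left one, so they agree. *)
Lemma inverse_mx_expr n (a b b' : 'M[R]_n) k :
  inverse_mx b b' -> a ^+ k.+1 = b -> exists a', inverse_mx a a'.
Proof.
move=> [bb' b'b] ab; exists (a ^+ k *m b').
have E1 : a *m (a ^+ k *m b') = 1%:M by rewrite mulmxA mulmxE -exprS ab.
have E2 : (b' *m a ^+ k) *m a = 1%:M by rewrite -mulmxA mulmxE -exprSr ab.
by split=> //; rewrite (inverse_mx_uniq E1 E2).
Qed.

Lemma inverse_dsum n m (a a' : 'M[R]_n) (b b' : 'M[R]_m) :
  inverse_mx a a' -> inverse_mx b b' -> inverse_mx (dsum a b) (dsum a' b').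
Proof.
move=> [aa' a'a] [bb' b'b].
by split; rewrite mulmx_block !(mulmx0, mul0mx, addr0, add0r) ?aa' ?bb' ?a'a ?b'b -scalar_mx_block.
Qed.

Lemma dsumM n m (a a' : 'M[R]_n) (b b' : 'M[R]_m) :
  dsum a b *m dsum a' b' = dsum (a *m a') (b *m b').
Proof. by rewrite mulmx_block !(mulmx0, mul0mx, addr0, add0r). Qed.

Lemma dsum11 n m : dsum (1%:M : 'M[R]_n) (1%:M : 'M[R]_m) = 1%:M.
Proof. by rewrite /dsum -scalar_mx_block. Qed.

Lemma generated_map (R' : nzRingType) n m (S : set 'M[R]_n) (S' : set 'M[R']_m)
    (f : 'M[R]_n -> 'M[R']_m) :
  f 1%:M = 1%:M -> {morph f : a b / a *m b} ->
  (forall a, S a -> generated S' (f a)) ->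
  forall a, generated S a -> generated S' (f a).
Proof.
move=> f1 fM fS a; elim=> {a} [|a|a b _ Ha _ Hb|a b _ Ha [ab ba]].
- by rewrite f1; apply: generated1.
- exact: fS.
- by rewrite fM; apply: generatedM.
- by apply: generatedV Ha _; split; rewrite -fM ?ab ?ba.
Qed.

Lemma support_mul0 n (p : pred 'I_n) (a b : 'M[R]_n) :
  (forall i j, a i j != 0 -> p i && ~~ p j) ->
  (forall i j, b i j != 0 -> p i && ~~ p j) -> a *m b = 0.
Proof.
move=> ha hb; apply/matrixP => i j; rewrite !mxE big1 // => k _.
have [->|/ha/andP[_ nk]] := eqVneq (a i k) 0; first by rewrite mul0r.
by have [->|/hb/andP[pk]] := eqVneq (b k j) 0; [rewrite mulr0 | rewrite pk in nk].
Qed.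

(** All nonzero entries go from rows in [p] to columns outside [p], so such matrices multiply to
    zero and $(1+x)(1+y)=1+x+y$. Splitting off one entry at a time gives a product of elementary
    generators; the induction is on the number of nonzero entries. *)
Lemma elementary_support n (p : pred 'I_n) (b : 'M[R]_n) :
  (forall i j, b i j != 0 -> p i && ~~ p j) -> elementary (1%:M + b).
Proof.
have [N] := ubnP #|[set ij : 'I_n * 'I_n | b ij.1 ij.2 != 0]%SET|.
elim: N b => // N IH b leN hb.
have [/existsP[[i j] /= bij]|/existsPn b0] :=
  boolP [exists ij : 'I_n * 'I_n, b ij.1 ij.2 != 0]; last first.
  suff -> : b = 0 by rewrite addr0; apply: generated1.
  apply/matrixP => i j; rewrite mxE; apply/eqP.
  by move: (b0 (i, j)); rewrite negbK.
pose x := b i j *: delta_mx i j.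
have xE u v : x u v = if (u == i) && (v == j) then b i j else 0.
  by rewrite !mxE; case: andP; rewrite ?mulr1 ?mulr0.
have bE u v : (b - x) u v = if (u == i) && (v == j) then 0 else b u v.
  rewrite 2!mxE xE; case: andP => [[/eqP-> /eqP->]|_]; first exact: subrr.
  by rewrite subr0.
have hx u v : x u v != 0 -> p u && ~~ p v.
  by rewrite xE; case: andP => [[/eqP-> /eqP-> /hb]|]; rewrite ?eqxx.
have hbx u v : (b - x) u v != 0 -> p u && ~~ p v.
  by rewrite bE; case: andP => [|_ /hb]; rewrite ?eqxx.
have -> : 1%:M + b = (1%:M + x) *m (1%:M + (b - x)).
  rewrite mulmxDl mul1mx mulmxDr mulmx1 (support_mul0 hx hbx) addr0.
  by rewrite -addrA subrK.
apply: generatedM.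
  apply: generated_in; exists i, j, (b i j); split=> //.
  by apply: contraL (hb _ _ bij) => /eqP->; rewrite andbN.
apply: IH hbx; rewrite -ltnS; apply: leq_trans leN; rewrite ltnS.
apply: proper_card; apply/properP; split.
  apply/fintype.subsetP => -[u v]; rewrite !inE /= bE.
  by case: ifP; rewrite ?eqxx.
by exists (i, j); rewrite !inE //= bE !eqxx.
Qed.

Lemma elementary_ublock n m (b : 'M[R]_(n, m)) : elementary (block_mx 1%:M b 0 1%:M).
Proof.
have -> : block_mx 1%:M b 0 1%:M = 1%:M + block_mx 0 b 0 0 :> 'M[R]_(n + m).
  by rewrite scalar_mx_block add_block_mx !(addr0, add0r).
apply: (@elementary_support _ (fun i => i < n)%N) => i j.
rewrite -(splitK i) -(splitK j); case: (split i) => u; case: (split j) => v /=.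
- by rewrite block_mxEul mxE eqxx.
- by rewrite ltn_ord -leqNgt leq_addr.
- by rewrite block_mxEdl mxE eqxx.
- by rewrite block_mxEdr mxE eqxx.
Qed.

Lemma elementary_lblock n m (c : 'M[R]_(m, n)) : elementary (block_mx 1%:M 0 c 1%:M).
Proof.
have -> : block_mx 1%:M 0 c 1%:M = 1%:M + block_mx 0 0 c 0 :> 'M[R]_(n + m).
  by rewrite scalar_mx_block add_block_mx !(addr0, add0r).
apply: (@elementary_support _ (fun i => n <= i)%N) => i j.
rewrite -(splitK i) -(splitK j); case: (split i) => u; case: (split j) => v /=.
- by rewrite block_mxEul mxE eqxx.
- by rewrite block_mxEur mxE eqxx.
- by rewrite leq_addr -ltnNge ltn_ord.
- by rewrite block_mxEdr mxE eqxx.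
Qed.

(** Whitehead's lemma: the first triple product is the block antidiagonal matrix with blocks [a] and
    [- a'], the second the one with blocks $-1$ and $1$. *)
Lemma elementary_dsum_inv n (a a' : 'M[R]_n) :
  inverse_mx a a' -> elementary (dsum a a').
Proof.
move=> [aa' a'a].
have -> : dsum a a' =
    (block_mx 1%:M a 0 1%:M *m block_mx 1%:M 0 (- a') 1%:M *m block_mx 1%:M a 0 1%:M)
    *m (block_mx 1%:M (- 1%:M) 0 1%:M *m block_mx 1%:M 0 1%:M 1%:M
        *m block_mx 1%:M (- 1%:M) 0 1%:M).
  rewrite !mulmx_block !(mulmx0, mul0mx, mulmx1, mul1mx, addr0, add0r, mulmxN, mulNmx).
  rewrite aa' a'a.
  by rewrite !(subrr, addNr, mul0mx, add0r, addr0, oppr0, opprK, mulmx0, sub0r, mulmx1, mul1mx,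
    mulNmx, mulmxN).
by do !apply: generatedM; first [exact: elementary_ublock | exact: elementary_lblock].
Qed.

Lemma elementary_dsum1 n m (e : 'M[R]_n) :
  elementary e -> elementary (dsum e (1%:M : 'M[R]_m)).
Proof.
apply: (generated_map (f := fun a => dsum a 1%:M)) => [|a b|_ [i [j [x [ij ->]]]]].
- exact: dsum11.
- by rewrite dsumM mulmx1.
- apply: generated_in; exists (lshift m i), (lshift m j), x; split.
    by rewrite (inj_eq (@lshift_inj _ _)).
  rewrite /dsum delta_mx_lshift delta_mx_ushift scalar_mx_block.
  have -> : row_mx (col_mx (delta_mx i j) 0) 0 = block_mx (delta_mx i j) 0 0 0
      :> 'M[R]_(n + m) by rewrite block_mxEh col_mx0.
  rewrite scale_block_mx add_block_mx.
  by rewrite !(scaler0, addr0).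
Qed.
End Generation.

(** * Stabilization inside the infinite matrices *)

Section Embedding.
Variable R : nzRingType.

Lemma embedM m n (s t : 'M[R]_(n + n)) : embed m (s *m t) = embed m s *m embed m t.
Proof.
rewrite -[s]submxK -[t]submxK mulmx_block /embed !(block_mxKul, block_mxKur, block_mxKdl, block_mxKdr).
rewrite mulmx_block !dsumM !(mulmx0, mulmx1).
by congr block_mx; rewrite add_block_mx !(addr0, add0r).
Qed.

Lemma embed1 m n : embed m (1%:M : 'M[R]_(n + n)) = 1%:M.
Proof.
rewrite /embed [1%:M in LHS]scalar_mx_block !(block_mxKul, block_mxKur, block_mxKdl, block_mxKdr).
by rewrite !dsum11 /dsum block_mx0 -scalar_mx_block.
Qed.

Lemma embedX m n (s : 'M[R]_(n + n)) k : embed m (s ^+ k) = embed m s ^+ k.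
Proof.
elim: k => [|k IH]; first exact: embed1.
by rewrite !exprS -IH -!mulmxE embedM.
Qed.

Lemma embed_block m n (a b c d : 'M[R]_n) :
  embed m (block_mx a b c d) = block_mx (dsum a 1%:M) (dsum b 0) (dsum c 0) (dsum d 1%:M).
Proof. by rewrite /embed !(block_mxKul, block_mxKur, block_mxKdl, block_mxKdr). Qed.

Variant ord_add_spec n m (k : nat) : option 'I_n -> option 'I_(n + m) -> Type :=
| OrdAddL i of k = val i : ord_add_spec k (Some i) (Some (lshift m i))
| OrdAddR j of k = (n + val j)%N : ord_add_spec k None (Some (rshift n j))
| OrdAddGe of (n + m <= k)%N : ord_add_spec k None None.

Lemma ord_addP n m k : @ord_add_spec n m k (insub k) (insub k).
Proof.
have [nmk|knm] := leqP (n + m) k.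
  rewrite !insubF; first exact: OrdAddGe.
    by rewrite ltnNge nmk.
  by rewrite ltnNge (leq_trans (leq_addr m n)).
rewrite -[k]/(val (Ordinal knm)) (valK (Ordinal knm)) -(splitK (Ordinal knm)).
case: (split _) => j /=.
  by rewrite (valK j); apply: OrdAddL.
by rewrite insubF; [apply: OrdAddR | rewrite ltnNge leq_addr].
Qed.

Lemma stable_embed m n (s : 'M[R]_(n + n)) : stable (embed m s) = stable s.
Proof.
have inlE (a b : nat) : (inl a == inl b :> nat + nat) = (a == b) by [].
have inrE (a b : nat) : (inr a == inr b :> nat + nat) = (a == b) by [].
apply/funext => x; apply/funext => y; rewrite /stable.
case: x => k; case: y => l; rewrite /trunc.
all: case: (ord_addP n m k) => [i ->|i ->|hk].
all: case: (ord_addP n m l) => [j ->|j ->|hl] //=.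
all: rewrite ?(block_mxEul, block_mxEur, block_mxEdl, block_mxEdr).
all: rewrite ?mxE // ?(inlE, inrE) ?eqn_add2l //.
all: by rewrite ?(gtn_eqF (ltn_addr _ (ltn_ord _))) ?(ltn_eqF (ltn_addr _ (ltn_ord _))).
Qed.

(** The sizes [p + m] and [n + d] agree only propositionally. The property is transported through
    the infinite matrices, where both embeddings become the same element. *)
Lemma embed_cast n p m d (s : 'M[R]_(n + n)) (t : 'M[R]_(p + p)) (S : forall q, set 'M[R]_(q + q)) :
  (p + m = n + d)%N -> stable t = stable s -> S _ (embed m t) -> S _ (embed d s).
Proof.
move=> e ts St; suff: exists2 t' : 'M[R]_((n + d) + (n + d)), S _ t' & stable t' = stable s.
  by case=> t' St' t's; rewrite (stable_inj (etrans (stable_embed d s) (esym t's))).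
rewrite -e; exists (embed m t) => //; by rewrite stable_embed.
Qed.

End Embedding.

(** * Adjoints and hyperbolic matrices *)

Section Star.
Variables (R : nzRingType) (F : form_ring R).
Local Notation star := (star F).

Lemma starE m n (a : 'M[R]_(m, n)) i j : star a i j = bar F (a j i).
Proof. by rewrite !mxE. Qed.

Lemma star0 m n : star (0 : 'M[R]_(m, n)) = 0.
Proof. by apply/matrixP => i j; rewrite starE !mxE bar0. Qed.

Lemma star1 n : star (1%:M : 'M[R]_n) = 1%:M.
Proof.
by apply/matrixP => i j; rewrite starE !mxE eq_sym; case: (i == j); rewrite ?bar1 ?bar0.
Qed.

Lemma starN m n (a : 'M[R]_(m, n)) : star (- a) = - star a.
Proof. by apply/matrixP => i j; rewrite starE !mxE barN. Qed.

Lemma starD m n (a b : 'M[R]_(m, n)) : star (a + b) = star a + star b.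
Proof. by apply/matrixP => i j; rewrite starE !mxE barD. Qed.

Lemma starM m n p (a : 'M[R]_(m, n)) (b : 'M[R]_(n, p)) : star (a *m b) = star b *m star a.
Proof.
apply/matrixP => i j; rewrite starE !mxE bar_sum.
by apply: eq_bigr => k _; rewrite barM !starE.
Qed.

Lemma starK m n (a : 'M[R]_(m, n)) : star (star a) = a.
Proof. by apply/matrixP => i j; rewrite !starE barK. Qed.

Lemma star_block m1 m2 n1 n2 (a : 'M[R]_(m1, n1)) (b : 'M_(m1, n2)) (c : 'M_(m2, n1)) (d : 'M_(m2, n2)) :
  star (block_mx a b c d) = block_mx (star a) (star c) (star b) (star d).
Proof. by rewrite /Defs.star tr_block_mx map_block_mx. Qed.

Lemma star_dsum n m (a : 'M[R]_n) (b : 'M[R]_m) : star (dsum a b) = dsum (star a) (star b).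
Proof. by rewrite star_block !star0. Qed.

Lemma inverse_star n (a a' : 'M[R]_n) : inverse_mx a a' -> inverse_mx (star a) (star a').
Proof. by move=> [aa' a'a]; split; rewrite -starM ?aa' ?a'a star1. Qed.

Lemma bar_lam : bar F (lam F) * lam F = 1.
Proof. by rewrite -lam_central lam_bar. Qed.

Lemma mulmxZlam m n p (a : 'M[R]_(m, n)) (b : 'M_(n, p)) : a *m (lam F *: b) = lam F *: (a *m b).
Proof.
apply/matrixP => i j; rewrite !mxE mulr_sumr; apply: eq_bigr => k _.
by rewrite mxE !mulrA lam_central.
Qed.

Lemma LamN x : Lam F x -> Lam F (- x).
Proof. by move=> hx; rewrite -sub0r; apply: LamB => //; apply: Lam0. Qed.

Lemma LamD x y : Lam F x -> Lam F y -> Lam F (x + y).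
Proof. by move=> hx hy; rewrite -[y]opprK; apply: LamB => //; apply: LamN. Qed.

Lemma Lam_sum (I : Type) (s : seq I) (P : pred I) (f : I -> R) :
  (forall i, P i -> Lam F (f i)) -> Lam F (\sum_(i <- s | P i) f i).
Proof. by move=> h; elim/big_ind: _ => //; [apply: Lam0 | apply: LamD]. Qed.

Lemma barLamP x : (bar F @` Lam F) x <-> Lam F (bar F x).
Proof.
split; first by case=> y hy <-; rewrite barK.
by move=> h; exists (bar F x) => //; rewrite barK.
Qed.

(* [a'] is meant to be the inverse of [a]. *)
Definition hyp n (a a' : 'M[R]_n) : 'M[R]_(n + n) := dsum a (star a').

Lemma hypM n (a a' b b' : 'M[R]_n) : hyp a a' *m hyp b b' = hyp (a *m b) (b' *m a').
Proof. by rewrite dsumM -starM. Qed.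

Lemma hyp1 n : hyp (1%:M : 'M[R]_n) 1%:M = 1%:M.
Proof. by rewrite /hyp star1 dsum11. Qed.

Lemma hypX n (a a' : 'M[R]_n) k : hyp a a' ^+ k = hyp (a ^+ k) (a' ^+ k).
Proof.
elim: k => [|k IH]; first by rewrite !expr0 -[1]/(1%:M) -hyp1.
by rewrite exprS IH -mulmxE hypM exprS exprSr !mulmxE.
Qed.

Lemma inverse_hyp n (a a' : 'M[R]_n) : inverse_mx a a' -> inverse_mx (hyp a a') (hyp a' a).
Proof. by move=> aa'; apply: inverse_dsum => //; apply/inverse_star/inverse_mx_sym. Qed.

Lemma embed_hyp m n (a a' : 'M[R]_n) : embed m (hyp a a') = hyp (dsum a 1%:M) (dsum a' 1%:M).
Proof. by rewrite /hyp /dsum embed_block star_block !star0 star1 /dsum !block_mx0. Qed.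

Lemma EQ_hyp n (a a' : 'M[R]_n) : elementary a -> inverse_mx a a' -> EQ F (hyp a a').
Proof. by move=> ha haa'; apply/generated_in/EQ_diag => //; apply: inverse_star. Qed.

End Star.

(** * The stable elementary quadratic group *)

Section StableEQ.
Variables (R : nzRingType) (F : form_ring R).

Lemma Lam_hermitian_dsum0 n m (c : 'M[R]_n) :
  Lam_hermitian F c -> Lam_hermitian F (dsum c (0 : 'M[R]_m)).
Proof.
move=> [hc hd]; split.
  by rewrite star_dsum star0 /dsum scale_block_mx !scaler0 opp_block_mx -hc !oppr0.
move=> i; rewrite -(splitK i); case: (split i) => j /=.
  by rewrite block_mxEul.
by rewrite block_mxEdr mxE; apply: Lam0.
Qed.

Lemma Lambar_hermitian_dsum0 n m (c : 'M[R]_n) :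
  Lambar_hermitian F c -> Lambar_hermitian F (dsum c (0 : 'M[R]_m)).
Proof.
move=> [hc hd]; split.
  by rewrite star_dsum star0 /dsum scale_block_mx !scaler0 opp_block_mx -hc !oppr0.
move=> i; rewrite -(splitK i); case: (split i) => j /=.
  by rewrite block_mxEul; apply: hd.
by rewrite block_mxEdr mxE; exists 0; [apply: Lam0 | rewrite bar0].
Qed.

Lemma EQ_embed m n (s : 'M[R]_(n + n)) : EQ F s -> EQ F (embed m s).
Proof.
apply: (generated_map (f := @embed R m n)) => [|a b|_ [e e' he hee'|b hb|c hc]].
- exact: embed1.
- exact: embedM.
- apply: generated_in; rewrite embed_block [dsum 0 _]block_mx0.
  apply: EQ_diag; first exact: elementary_dsum1.
  rewrite star_dsum star1; apply: inverse_dsum => //; exact: inverse_mx1.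
- apply: generated_in; rewrite embed_block dsum11 [dsum 0 _]block_mx0.
  exact/EQ_upper/Lambar_hermitian_dsum0.
- apply: generated_in; rewrite embed_block dsum11 [dsum 0 _]block_mx0.
  exact/EQ_lower/Lam_hermitian_dsum0.
Qed.

(** A witness at one level gives one at every later level by [EQ_embed]. Having all large [d] at
    hand lets two elements be treated at a common level. *)
Lemma EQstP n (s : 'M[R]_(n + n)) :
  EQst F (stable s) <-> exists m, forall d, (m <= d)%N -> EQ F (embed d s).
Proof.
split=> [[p _ [t tEQ ts]]|[m h]]; last first.
  by exists (n + m)%N => //; exists (embed m s); [apply: h | apply: stable_embed].
exists p => d pd; have e : (p + (n + d - p) = n + d)%N.
  by rewrite subnKC // (leq_trans pd (leq_addl n d)).
exact: (embed_cast e ts (EQ_embed _ tEQ)).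
Qed.

Lemma EQst_EQ n (s : 'M[R]_(n + n)) : EQ F s -> EQst F (stable s).
Proof. by move=> hs; exists n => //; exists s. Qed.

Lemma EQstM n (s t : 'M[R]_(n + n)) :
  EQst F (stable s) -> EQst F (stable t) -> EQst F (stable (s *m t)).
Proof.
move=> /EQstP[m hs] /EQstP[p ht]; apply/EQstP; exists (maxn m p) => d.
by rewrite geq_max embedM => /andP[md pd]; apply: generatedM; [apply: hs | apply: ht].
Qed.

Lemma EQstV n (s t : 'M[R]_(n + n)) :
  EQst F (stable s) -> inverse_mx s t -> EQst F (stable t).
Proof.
move=> /EQstP[m hs] [st ts]; apply/EQstP; exists m => d md.
by apply: generatedV (hs d md) _; split; rewrite -embedM ?st ?ts embed1.
Qed.

Lemma EQst1 n : EQst F (stable (1%:M : 'M[R]_(n + n))).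
Proof. exact/EQst_EQ/generated1. Qed.

(** In doubled size the hyperbolic matrix [g] of [dsum a a'] is elementary by Whitehead's lemma. It
    differs from the stabilized [hyp F a a'] by the factor [h], which acts only on the new
    coordinates and so commutes with [embed n s]. *)
Lemma EQst_conj_hyp n (a a' : 'M[R]_n) (s : 'M[R]_(n + n)) :
  inverse_mx a a' -> EQst F (stable s) -> EQst F (stable (hyp F a a' *m s *m hyp F a' a)).
Proof.
move=> aa' hs; have a'a := inverse_mx_sym aa'; rewrite -(stable_embed n) !embedM !embed_hyp.
pose g := hyp F (dsum a a') (dsum a' a).
have gE : EQ F g by apply: EQ_hyp; [apply: elementary_dsum_inv | apply: inverse_dsum].
have g'E : EQ F (hyp F (dsum a' a) (dsum a a')).
  by apply: EQ_hyp; [apply: elementary_dsum_inv | apply: inverse_dsum].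
suff -> : hyp F (dsum a 1%:M) (dsum a' 1%:M) *m embed n s *m hyp F (dsum a' 1%:M) (dsum a 1%:M)
    = g *m embed n s *m hyp F (dsum a' a) (dsum a a').
  do 2?[apply: EQstM]; try exact: EQst_EQ.
  by rewrite stable_embed.
have [e1 e2] := aa'.
pose h := hyp F (dsum (1%:M : 'M_n) a') (dsum 1%:M a).
have -> : g = hyp F (dsum a 1%:M) (dsum a' 1%:M) *m h.
  by rewrite hypM !dsumM !mul1mx !mulmx1.
have -> : hyp F (dsum a' a) (dsum a a') =
    hyp F (dsum 1%:M a) (dsum 1%:M a') *m hyp F (dsum a' 1%:M) (dsum a 1%:M).
  by rewrite hypM !dsumM !mul1mx !mulmx1.
rewrite -!mulmxA; congr (_ *m _); rewrite !mulmxA; congr (_ *m _).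
rewrite -[LHS]mulmx1 -(_ : h *m hyp F (dsum 1%:M a) (dsum 1%:M a') = 1%:M); last first.
  by rewrite hypM !dsumM !mulmx1 !e2 !dsum11 hyp1.
rewrite mulmxA; congr (_ *m _).
rewrite /h /hyp /embed star_dsum star1 mulmx_block [RHS]mulmx_block.
rewrite !dsumM !(mulmx0, mul0mx, addr0, add0r, mulmx1, mul1mx, dsumM).
by congr block_mx; rewrite ?mulmx_block ?add_block_mx !(mulmx0, mul0mx, addr0, add0r, mulmx1, mul1mx).
Qed.

(** Hyperbolic matrices normalize the stable elementary group, so [e1] and [e2] can be moved to the
    left through every power: $s^k=f\,H(a)^k$ with $f$ stably elementary. *)
Lemma EQst_peel n (s e1 e2 e1' e2' : 'M[R]_(n + n)) (a a' : 'M[R]_n) k :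
  inverse_mx a a' -> inverse_mx e1 e1' -> inverse_mx e2 e2' ->
  EQst F (stable e1) -> EQst F (stable e2) ->
  s = e1 *m hyp F a a' *m e2 ->
  EQst F (stable (s ^+ k)) -> EQst F (stable (hyp F a a' ^+ k)).
Proof.
move=> aa' he1 he2 E1 E2 -> hs.
suff [f [f' [hf Ef Hf]]] : exists f f', [/\ inverse_mx f f', EQst F (stable f) &
    (e1 *m hyp F a a' *m e2) ^+ k = f *m hyp F a a' ^+ k].
  have -> : hyp F a a' ^+ k = f' *m (e1 *m hyp F a a' *m e2) ^+ k.
    by rewrite Hf mulmxA; case: hf => _ ->; rewrite mul1mx.
  by apply: EQstM hs; apply: EQstV Ef hf.
elim: k {hs} => [|k [f [f' [hf Ef Hf]]]].
  exists 1%:M, 1%:M; rewrite !expr0 mul1mx; split=> //; [exact: inverse_mx1 | exact: EQst1].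
have hh := inverse_hyp F aa'.
(* With $h=H(a)$, the relation $s^k=fh^k$ gives $s^{k+1}=e_1\,(h\,e_2f\,h^{-1})\,h^{k+1}$. *)
exists (e1 *m (hyp F a a' *m (e2 *m f) *m hyp F a' a)).
exists (hyp F a a' *m (f' *m e2') *m hyp F a' a *m e1'); split.
- apply: inverse_mxM => //; rewrite -[X in inverse_mx _ X]mulmxA; apply: inverse_mxM.
    by apply: inverse_mxM => //; apply: inverse_mxM.
  exact: inverse_mx_sym.
- by apply: EQstM => //; apply: EQst_conj_hyp => //; apply: EQstM.
rewrite exprS Hf exprS -!mulmxE -!mulmxA; do 4!congr (_ *m _).
by rewrite mulmxA; case: hh => _ ->; rewrite mul1mx.
Qed.

End StableEQ.

(** * Hermitian matrices and the block factorization *)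

Section Hermitian.
Variables (R : nzRingType) (F : form_ring R).
Local Notation star := (star F).

(** The diagonal terms lie in $\Lambda$, and each off-diagonal pair adds up to an element
    $x-\lambda\overline x$ of $\Lambda_{\min}$. *)
Lemma Lam_sum_sym n (f : 'I_n -> 'I_n -> R) :
  (forall i, Lam F (f i i)) -> (forall i j, f i j = - (lam F * bar F (f j i))) ->
  Lam F (\sum_i \sum_j f i j).
Proof.
elim: n f => [|n IH] f hd hf; first by rewrite big_ord0; apply: Lam0.
rewrite big_ord_recr /= [X in _ + X]big_ord_recr /= addrA; apply: LamD; last exact: hd.
under eq_bigr do rewrite big_ord_recr /=.
rewrite big_split /= -addrA; apply: LamD; first by apply: IH => *; [apply: hd | apply: hf].
rewrite -big_split; apply: Lam_sum => i _ /=.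
by rewrite (hf ord_max); apply: Lam_min.
Qed.

Lemma Lam_hermitian_conj n m (x : 'M[R]_(n, m)) (c : 'M[R]_n) :
  Lam_hermitian F c -> Lam_hermitian F (star x *m c *m x).
Proof.
move=> [hc hd]; split.
  by rewrite !starM starK {1}hc mulmxA mulmxN mulNmx mulmxZlam -scalemxAl.
move=> i; pose f u v := bar F (x u i) * c u v * x v i.
have -> : (star x *m c *m x) i i = \sum_u \sum_v f u v.
  rewrite mxE exchange_big; apply: eq_bigr => u _ /=.
  by rewrite mxE mulr_suml; apply: eq_bigr => v _; rewrite starE.
apply: Lam_sum_sym => [u|u v]; first exact: Lam_conj.
rewrite /f 2!barM barK {1}hc !mxE mulrN mulNr !mulrA.
by rewrite (lam_central F (bar F (x u i))).
Qed.

Lemma Lam_hermitianB n (b c : 'M[R]_n) :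
  Lam_hermitian F b -> Lam_hermitian F c -> Lam_hermitian F (b - c).
Proof.
move=> [hb db] [hc dc]; split; last by move=> i; rewrite !mxE; apply: LamB.
by rewrite starD starN scalerBr opprB {1}hb {1}hc opprK addrC.
Qed.

(** Reduces questions on $\overline\Lambda$-Hermitian matrices to the closure properties proved for
    $\Lambda$. *)
Lemma Lambar_hermitianE n (b : 'M[R]_n) :
  Lambar_hermitian F b <-> Lam_hermitian F (star b).
Proof.
split=> [] [hb db].
  split; last by move=> i; rewrite starE; apply/barLamP.
  by rewrite starK {2}hb scalerN opprK scalerA lam_bar scale1r.
split; last by move=> i; apply/barLamP; rewrite -starE.
by rewrite hb starK scalerN opprK scalerA bar_lam scale1r.
Qed.

Lemma inverse_ublock n (b : 'M[R]_n) :
  inverse_mx (block_mx 1%:M b 0 1%:M : 'M_(n + n)) (block_mx 1%:M (- b) 0 1%:M).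
Proof.
split; rewrite mulmx_block !(mulmx0, mul0mx, mulmx1, mul1mx, addr0, add0r) ?addNr ?subrr;
  by rewrite -scalar_mx_block.
Qed.

Lemma inverse_lblock n (c : 'M[R]_n) :
  inverse_mx (block_mx 1%:M 0 c 1%:M : 'M_(n + n)) (block_mx 1%:M 0 (- c) 1%:M).
Proof.
split; rewrite mulmx_block !(mulmx0, mul0mx, mulmx1, mul1mx, addr0, add0r) ?addNr ?subrr;
  by rewrite -scalar_mx_block.
Qed.

(** Block elimination with the invertible corner $a$: the lower factor is
    $ca^{-1}=(a^{-1})^*(a^*c)a^{-1}$, Hermitian because $a^*c$ is, and the upper one is $a^{-1}b$.
    The defining relations force $d=(a^{-1})^*+ca^{-1}b$, so the middle factor is $H(a)$. *)
Lemma GQ_factor n (s : 'M[R]_(n + n)) (a' : 'M[R]_n) :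
  GQ F s -> inverse_mx (ulsubmx s) a' ->
  exists b c, [/\ Lambar_hermitian F b, Lam_hermitian F c &
    s = block_mx 1%:M 0 c 1%:M *m hyp F (ulsubmx s) a' *m block_mx 1%:M b 0 1%:M].
Proof.
case=> _; rewrite -[s]submxK !(block_mxKul, block_mxKur, block_mxKdl, block_mxKdr).
move: (ulsubmx s) (ursubmx s) (dlsubmx s) (drsubmx s) => a b c d {s}.
rewrite star_block /psi -[(lam F)%:M]scalemx1 !mulmx_block !(mulmxZlam, mulmx0, mulmx1, addr0, add0r).
rewrite -!scalemxAl => /eq_block_mx[e1 e2 e3 e4] hac hbd [aa' a'a].
have [as' s'a] : inverse_mx (star a) (star a') by apply: inverse_star.
have hc : Lam_hermitian F (c *m a').
  have -> : c *m a' = star a' *m (star a *m c) *m a' by rewrite !mulmxA s'a mul1mx.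
  apply: Lam_hermitian_conj; split=> //.
  by apply/eqP; rewrite starM starK -addr_eq0 addrC e1.
have dE : d = star a' + c *m a' *m b.
  have -> : d = star a' *m (1%:M - lam F *: (star c *m b)).
    by rewrite -e2 addrAC subrr add0r mulmxA s'a mul1mx.
  rewrite mulmxBr mulmx1; congr (_ + _); rewrite mulmxZlam.
  have -> : c *m a' = star a' *m (star a *m c) *m a' by rewrite !mulmxA s'a mul1mx.
  have -> : star a *m c = - (lam F *: (star c *m a)).
    by apply/eqP; rewrite -addr_eq0 addrC e1.
  rewrite mulmxN !mulNmx mulmxZlam -!scalemxAl; congr (- (_ *: _)).
  by rewrite -!mulmxA (mulmxA a) aa' mul1mx.
exists (a' *m b), (c *m a'); split=> //.
  apply/Lambar_hermitianE.
  (* Since $(a^{-1})^*=d-ca^{-1}b$, the adjoint of $a^{-1}b$ is $b^*d$ minus a conjugate of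
     $ca^{-1}$, and both are $\Lambda$-Hermitian. *)
  have -> : star (a' *m b) = star b *m d - star b *m (c *m a') *m b.
    by rewrite dE mulmxDr mulmxA addrK starM.
  apply: Lam_hermitianB; last exact: Lam_hermitian_conj.
  by split=> //; apply/eqP; rewrite starM starK -addr_eq0 addrC e4.
rewrite mulmx_block !(mulmx0, mul0mx, mulmx1, mul1mx, addr0, add0r).
rewrite mulmx_block !(mulmx0, mul0mx, mulmx1, mul1mx, addr0, add0r).
by rewrite !mulmxA aa' mul1mx -(mulmxA c) a'a mulmx1 addrC -dE.
Qed.

End Hermitian.

(** * Functoriality in the form ring *)

Section Functoriality.
Variables (R S : nzRingType) (F : form_ring R) (G : form_ring S) (f : {rmorphism R -> S}).
Hypotheses (f_bar : forall x, f (bar F x) = bar G (f x)) (f_lam : f (lam F) = lam G)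
  (f_Lam : forall x, Lam F x -> Lam G (f x)).

Lemma map_elementary n (e : 'M[R]_n) : elementary e -> elementary (map_mx f e).
Proof.
apply: (generated_map (f := map_mx f)) => [|a b|_ [i [j [x [ij ->]]]]].
- by rewrite map_mx1.
- by rewrite map_mxM.
- apply: generated_in; exists i, j, (f x); split=> //.
  by rewrite map_mxD map_mx1 map_mxZ map_delta_mx.
Qed.

Lemma map_star m n (a : 'M[R]_(m, n)) : map_mx f (star F a) = star G (map_mx f a).
Proof. by apply/matrixP => i j; rewrite !mxE f_bar. Qed.

Lemma map_EQ n (s : 'M[R]_(n + n)) : EQ F s -> EQ G (map_mx f s).
Proof.
apply: (generated_map (f := map_mx f)) => [|a b|_ [e e' he [h1 h2]|b [hb db]|c [hc dc]]].
- by rewrite map_mx1.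
- by rewrite map_mxM.
- apply: generated_in; rewrite map_block_mx !map_mx0; apply: EQ_diag; first exact: map_elementary.
  by split; rewrite -map_star -map_mxM ?h1 ?h2 map_mx1.
- apply: generated_in; rewrite map_block_mx map_mx0 !map_mx1; apply: EQ_upper; split.
    by rewrite {1}hb map_mxN map_mxZ map_star f_bar f_lam.
  move=> i; have /barLamP hi := db i; apply/barLamP.
  by rewrite mxE -f_bar; apply: f_Lam.
- apply: generated_in; rewrite map_block_mx map_mx0 !map_mx1; apply: EQ_lower; split.
    by rewrite {1}hc map_mxN map_mxZ map_star f_lam.
  by move=> i; rewrite mxE; apply: f_Lam.
Qed.

Lemma map_embed m n (s : 'M[R]_(n + n)) : map_mx f (embed m s) = embed m (map_mx f s).
Proof.
rewrite -[s]submxK embed_block [in RHS]map_block_mx embed_block.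
by rewrite !map_block_mx !map_mx1 !map_mx0.
Qed.

Lemma map_EQst n (s : 'M[R]_(n + n)) : EQst F (stable s) -> EQst G (stable (map_mx f s)).
Proof.
by move=> /EQstP[m h]; apply/EQstP; exists m => d md; rewrite -map_embed; apply/map_EQ/h.
Qed.

End Functoriality.

Section Evaluation.
Variables (R : nzRingType) (F : form_ring R).
Local Notation G := (poly_form_ring F).

Lemma EQst_polyC n (s : 'M[R]_(n + n)) :
  EQst F (stable s) -> EQst G (stable (map_mx polyC s)).
Proof.
apply: (map_EQst (f := polyC)) => // [x|x hx i]; first by rewrite /= bar_polyC.
by rewrite coefC; case: eqP => // _; apply: Lam0.
Qed.

Lemma EQst_coef0 n (s : 'M[{poly R}]_(n + n)) :
  EQst G (stable s) -> EQst F (stable (map_mx (coefp 0) s)).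
Proof.
apply: (map_EQst (f := coefp 0)) => [x||x hx]; last exact: hx.
  by rewrite /= coef_bar.
by rewrite /= coefC.
Qed.

Lemma inverse_map (S : nzRingType) (f : {rmorphism R -> S}) n (a a' : 'M[R]_n) :
  inverse_mx a a' -> inverse_mx (map_mx f a) (map_mx f a').
Proof. by move=> [h1 h2]; split; rewrite -map_mxM ?h1 ?h2 map_mx1. Qed.

End Evaluation.

(** * Classes as cosets *)

Section StableClasses.
Variables (R : nzRingType) (F : form_ring R).

Lemma stable_one n : stable (1%:M : 'M[R]_(n + n)) = stable (1%:M : 'M[R]_(0 + 0)).
Proof. by rewrite -(stable_embed n (1%:M : 'M_(0 + 0))) embed1. Qed.

Lemma K1oneE : K1one F = EQst F.
Proof.
apply/seteqP; split=> z.
  move=> [n [s [t [/= hs ht ->]]]]; move: hs; rewrite -(stable_one n) => /stable_inj->.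
  by rewrite mul1mx.
move=> [n _ [t tEQ <-]]; exists n, 1%:M, t; split; rewrite ?mul1mx //=; first exact: stable_one.
exact: EQst_EQ.
Qed.

Lemma stable_level n q (s : 'M[R]_(n + n)) :
  (n <= q)%N -> exists s' : 'M_(q + q), stable s' = stable s.
Proof. by move=> /subnKC <-; exists (embed (q - n) s); apply: stable_embed. Qed.

Lemma K1class_one n (s s' : 'M[R]_(n + n)) :
  inverse_mx s s' -> EQst F (stable s) -> K1class F s = K1one F.
Proof.
move=> [ss' s's] sE; rewrite K1oneE; apply/seteqP; split=> z.
  move=> [p [u [t [/= hu ht ->]]]]; apply: EQstM => //.
  by rewrite hu.
move=> [p _ [t tEQ <-]].
have [t' ht'] := stable_level t (leq_addl n p).
have e1 : embed p s *m embed p s' = 1%:M by rewrite -embedM ss' embed1.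
have e2 : embed p s' *m embed p s = 1%:M by rewrite -embedM s's embed1.
exists (n + p)%N, (embed p s), (embed p s' *m t'); split.
- exact: stable_embed.
- apply: EQstM; last by rewrite ht'; apply: EQst_EQ.
  by apply: (EQstV (s := embed p s)) => //; rewrite stable_embed.
- by rewrite mulmxA e1 mul1mx ht'.
Qed.

Lemma K1class_refl n (s : 'M[R]_(n + n)) : K1class F s (stable s).
Proof. by exists n, s, 1%:M; split; rewrite ?mulmx1 //; apply: EQst1. Qed.

(** One representative of the power suffices: once the power is the trivial class, [K1oneE] puts
    [s ^+ k] into the stable elementary group. *)
Lemma K1expX n (s : 'M[R]_(n + n)) k : K1exp F (K1class F s) k (stable (s ^+ k)).
Proof.
elim: k => [|k IH]; first by rewrite /K1exp /= K1oneE; apply: EQst1.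
exists n, s, (s ^+ k); split=> //; first exact: K1class_refl.
by rewrite mulmxE exprS.
Qed.

End StableClasses.

(** * Triangular matrices and matrices over a matrix ring *)

Section MatrixRing.
Variable R : nzRingType.

(** Such a [b] is strictly triangular for the ordering of indices by [f]. The rows where [f] takes
    the top value [K] form a matrix [t] covered by [elementary_support]; since [(b - t) *m t = 0],
    the factor [1%:M + t] splits off and the bound drops. *)
Lemma elementary_strict n (f : 'I_n -> nat) (b : 'M[R]_n) :
  (forall i j, b i j != 0 -> (f j < f i)%N) -> elementary (1%:M + b).
Proof.
move=> hb; pose K := (\max_i f i).+1.
have {}hb i j : b i j != 0 -> (f j < f i < K)%N.
  by move=> /hb->; rewrite ltnS; apply: (leq_bigmax i).
elim: K b hb => [|K IH] b hb.
  suff -> : b = 0 by rewrite addr0; apply: generated1.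
  by apply/matrixP => i j; rewrite mxE; apply/eqP/contraT => /hb; rewrite ltn0 andbF.
pose t := \matrix_(i, j) if f i == K then b i j else 0.
have tE i j : t i j = if f i == K then b i j else 0 by rewrite mxE.
have bE i j : (b - t) i j = if f i == K then 0 else b i j.
  by rewrite 2!mxE tE; case: eqP; rewrite ?subrr ?subr0.
have ht i j : t i j != 0 -> (f i == K) && (f j != K).
  by rewrite tE; have [<- /hb/andP[/ltn_eqF-> _]|_] := eqVneq (f i) K; rewrite ?eqxx.
have hbt i j : (b - t) i j != 0 -> (f j < f i < K)%N.
  rewrite bE; have [|ne /hb] := eqVneq (f i) K; first by rewrite eqxx.
  by rewrite [(f i < K)%N]ltn_neqAle ne.
have -> : 1%:M + b = (1%:M + (b - t)) *m (1%:M + t).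
  rewrite mulmxDl mul1mx mulmxDr mulmx1 [(b - t) *m t](_ : _ = 0); last first.
    apply/matrixP => i j; rewrite !mxE big1 // => l _.
    rewrite tE; have [lK|] := eqVneq (f l) K; last by rewrite mulr0.
    have [->|/hbt] := eqVneq ((b - t) i l) 0; first by rewrite mul0r.
    by rewrite lK => /andP[/ltn_trans h /h]; rewrite ltnn.
  by rewrite addr0 -addrA (addrC t) subrK.
by apply: generatedM; [apply: IH | apply: (elementary_support (p := fun i => f i == K))].
Qed.

Lemma nilpotent_inverse (A : pzRingType) (w : A) m :
  w ^+ m = 0 -> let v := \sum_(i < m) w ^+ i in (1 - w) * v = 1 /\ v * (1 - w) = 1.
Proof.
move=> wm v; have e : (1 - w) * v = 1.
  by rewrite -opprB mulNr -subrX1 wm sub0r opprK.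
split=> //; rewrite -[RHS]e /v mulrBl mulrBr mul1r mulr1; congr (_ - _).
by rewrite mulr_suml mulr_sumr; apply: eq_bigr => i _; rewrite -exprS exprSr.
Qed.

(* identifies n x n matrices over the ring of m x m matrices with matrices
   made of m x m blocks of size n *)
Definition flat m n (a : 'M['M[R]_m]_n) : 'M[R]_(m * n) :=
  \matrix_(i, j) a (mxtens_unindex i).2 (mxtens_unindex j).2
                   (mxtens_unindex i).1 (mxtens_unindex j).1.

Lemma flatE m n (a : 'M['M[R]_m]_n) u p v q :
  flat a (mxtens_index (u, p)) (mxtens_index (v, q)) = a p q u v.
Proof. by rewrite mxE !mxtens_indexK. Qed.

Lemma flat_eq m n (A B : 'M[R]_(m * n)) :
  (forall u p v q, A (mxtens_index (u, p)) (mxtens_index (v, q)) =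
     B (mxtens_index (u, p)) (mxtens_index (v, q))) -> A = B.
Proof.
move=> h; apply/matrixP => i j; rewrite -[i]mxtens_unindexK -[j]mxtens_unindexK.
by case: (mxtens_unindex i) => u p; case: (mxtens_unindex j) => v q.
Qed.

Lemma flatD m n (a b : 'M['M[R]_m]_n) : flat (a + b) = flat a + flat b.
Proof. by apply/matrixP => i j; rewrite !mxE. Qed.

Lemma flat1 m n : flat (1%:M : 'M['M[R]_m]_n) = 1%:M.
Proof.
apply: flat_eq => u p v q; rewrite flatE !mxE.
rewrite (inj_eq (can_inj (@mxtens_indexK _ _))) xpair_eqE andbC.
by case: (p == q); rewrite ?mulr1n ?mulr0n !mxE //; case: (u == v).
Qed.

Lemma flatM m n (a b : 'M['M[R]_m]_n) : flat (a *m b) = flat a *m flat b.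
Proof.
apply: flat_eq => u p v q; rewrite flatE !mxE summxE.
transitivity (\sum_(k < m * n) a p (mxtens_unindex k).2 u (mxtens_unindex k).1 *
    b (mxtens_unindex k).2 q (mxtens_unindex k).1 v); last first.
  by apply: eq_bigr => k _; rewrite !mxE !mxtens_indexK.
rewrite (reindex (@mxtens_index m n)); last first.
  by exists (@mxtens_unindex m n) => i; rewrite (mxtens_indexK, mxtens_unindexK).
under [RHS]eq_bigr do rewrite !mxtens_indexK.
rewrite -(pair_bigA _ (fun w r => a p r u w * b r q w v)) /= exchange_big.
by apply: eq_bigr => r _; rewrite mxE.
Qed.

(** As [m.+1 * n] computes to [n + m * n], a flattened matrix is also a two by two block matrix,
    whose first part belongs to block index 0. *)
Lemma mxtens_unindex_lshift m n (p : 'I_n) :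
  mxtens_unindex (lshift (m * n) p : 'I_(m.+1 * n)) = (ord0, p).
Proof.
rewrite -[RHS]mxtens_indexK; congr mxtens_unindex; apply: val_inj => /=.
by rewrite mul0n.
Qed.

Lemma mxtens_unindex_rshift m n (k : 'I_(m * n)) :
  (mxtens_unindex (rshift n k : 'I_(m.+1 * n))).1 = lift ord0 (mxtens_unindex k).1.
Proof.
rewrite -{1}[k]mxtens_unindexK; case: (mxtens_unindex k) => u p.
suff -> : rshift n (mxtens_index (u, p)) = mxtens_index (lift ord0 u, p) :> 'I_(m.+1 * n).
  by rewrite mxtens_indexK.
by apply: val_inj; rewrite /= /bump /= mulnDl mul1n addnA.
Qed.

End MatrixRing.

(** * Transfer along the substitution of a matrix for $X$ *)

Section Transfer.
Variables (R : nzRingType) (F : form_ring R).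
Local Notation S := {poly R}.
Local Notation G := (poly_form_ring F).
Variables (Z : comNzRingType) (io : {rmorphism Z -> S}).
Hypotheses (io_comm : forall z p, io z * p = p * io z)
  (io_bar : forall z, bar G (io z) = io z)
  (io_Lam : forall z p, Lam G p -> Lam G (io z * p)).
Variables (m : nat) (P J J' : 'M[Z]_m.+1).
Hypotheses (J_sym : J^T = J) (JJ' : J *m J' = 1%:M) (J'J : J' *m J = 1%:M)
  (JP : J *m P = P^T *m J).

Local Notation "M ^io" := (map_mx io M) (at level 2, format "M ^io").

Lemma io_scalar_comm (Q : 'M[Z]_m.+1) (p : S) : p%:M *m Q^io = Q^io *m p%:M.
Proof.
rewrite mul_scalar_mx -diag_const_mx mul_mx_diag; apply/matrixP => i j.
by rewrite !mxE io_comm.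
Qed.


Definition polyM (c : R) : 'M[S]_m.+1 := (c%:P)%:M.

Fact polyM_comm : commr_rmorph polyM P^io.
Proof. by move=> c; rewrite /GRing.comm -!mulmxE io_scalar_comm. Qed.

Fact polyM_is_zmod_morphism : zmod_morphism polyM.
Proof. by move=> c d; rewrite /polyM !rmorphB. Qed.

Fact polyM_is_monoid_morphism : monoid_morphism polyM.
Proof. by split=> [|c d]; rewrite /polyM ?rmorph1 // !rmorphM. Qed.

HB.instance Definition _ := GRing.isZmodMorphism.Build R 'M[S]_m.+1 polyM polyM_is_zmod_morphism.
HB.instance Definition _ := GRing.isMonoidMorphism.Build R 'M[S]_m.+1 polyM polyM_is_monoid_morphism.

(** The substitution $X\mapsto P$, with coefficients sent to scalar matrices; it is multiplicative
    because the entries of $P$ act centrally. *)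
Definition subst : {rmorphism S -> 'M[S]_m.+1} := horner_morph polyM_comm.

Lemma substMXaddC q c : subst (q * 'X + c%:P) = subst q *m P^io + c%:P%:M.
Proof. by rewrite rmorphD rmorphM /= horner_morphC horner_morphX. Qed.

Lemma subst_comm q : subst q *m P^io = P^io *m subst q.
Proof.
have XE : P^io = subst 'X by rewrite /= horner_morphX.
by rewrite XE !mulmxE -!rmorphM commr_polyX.
Qed.

Lemma subst_Lam c i j : Lam G c -> Lam G (subst c i j).
Proof.
elim/poly_ind: c i j => [|q c IH] i j h; first by rewrite rmorph0 mxE; apply: Lam0.
rewrite substMXaddC 2!mxE; apply: LamD.
  apply: Lam_sum => u _; rewrite mxE -io_comm; apply/io_Lam/IH => l.
  by have := h l.+1; rewrite coefD coefMX coefC addr0.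
rewrite mxE; case: (i == j); last by apply: Lam0.
by move=> l; have := h 0; rewrite coefD coefMX add0r mulr1n !coefC /=; case: eqP => // _ _; apply: Lam0.
Qed.

Lemma star_io (Q : 'M[Z]_m.+1) : star G Q^io = (Q^T)^io.
Proof. by apply/matrixP => i j; rewrite !mxE io_bar. Qed.

Lemma J'_sym : J'^T = J'.
Proof.
have h : J'^T *m J = 1%:M by rewrite -{1}J_sym -trmx_mul JJ' trmx1.
by rewrite -[LHS]mulmx1 -JJ' mulmxA h mul1mx.
Qed.

(** Hypothesis [JP] says $P^T=JPJ^{-1}$, and $P^*=P^T$ as the scalars are self-adjoint. The reversal
    of products by the adjoint is harmless, since [subst q] commutes with $P$. *)
Lemma star_subst p : star G (subst p) = J^io *m subst (bar G p) *m J'^io.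
Proof.
have JJ'io : J^io *m J'^io = 1%:M by rewrite -map_mxM JJ' map_mx1.
have J'Jio : J'^io *m J^io = 1%:M by rewrite -map_mxM J'J map_mx1.
elim/poly_ind: p => [|q c IH].
  by rewrite (bar0 G) !rmorph0 star0 mulmx0 mul0mx.
have -> : bar G (q * 'X + c%:P) = bar G q * 'X + (bar F c)%:P.
  by rewrite barD barM /= bar_polyX bar_polyC commr_polyX.
rewrite !substMXaddC starD starM IH star_io subst_comm.
have -> : P^T^io = J^io *m P^io *m J'^io.
  by rewrite -!map_mxM JP -mulmxA JJ' mulmx1.
rewrite mulmxDr mulmxDl; congr (_ + _).
  by rewrite !mulmxA -(mulmxA _ J'^io) J'Jio mulmx1.
rewrite -io_scalar_comm -mulmxA JJ'io mulmx1.
apply/matrixP => i j; rewrite !mxE eq_sym; case: (i == j).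
  by rewrite !mulr1n /= bar_polyC.
by rewrite !mulr0n bar0.
Qed.

Definition transfer n (a : 'M[S]_n) : 'M[S]_(m.+1 * n) := flat (map_mx subst a).

(** The form [J] repeated on each of the [n] coordinates; it corrects the adjoint of [transfer]. *)
Definition flatJ n : 'M[S]_(m.+1 * n) := flat (J^io)%:M.
Definition flatJ' n : 'M[S]_(m.+1 * n) := flat (J'^io)%:M.

Lemma flatJJ' n : flatJ n *m flatJ' n = 1%:M.
Proof. by rewrite -flatM -scalar_mxM -mulmxE -map_mxM JJ' map_mx1 flat1. Qed.

Lemma flatJ'J n : flatJ' n *m flatJ n = 1%:M.
Proof. by rewrite -flatM -scalar_mxM -mulmxE -map_mxM J'J map_mx1 flat1. Qed.

Lemma transferM n (a b : 'M[S]_n) : transfer (a *m b) = transfer a *m transfer b.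
Proof. by rewrite /transfer map_mxM flatM. Qed.

Lemma transferD n (a b : 'M[S]_n) : transfer (a + b) = transfer a + transfer b.
Proof. by rewrite /transfer map_mxD flatD. Qed.

Lemma transfer1 n : transfer (1%:M : 'M[S]_n) = 1%:M.
Proof. by rewrite /transfer map_mx1 flat1. Qed.

Lemma transfer0 n : transfer (0 : 'M[S]_n) = 0.
Proof. by apply: (addrI (transfer 0)); rewrite -transferD !addr0. Qed.

Lemma transferNlam n (a : 'M[S]_n) :
  transfer (- (lam G *: a)) = - (lam G *: transfer a).
Proof.
apply: flat_eq => u p v q; rewrite flatE !mxE !mxtens_indexK /= rmorphN rmorphM /=.
by rewrite horner_morphC mxE -mulmxE mul_scalar_mx !mxE.
Qed.

Lemma star_flatJ n : star G (flatJ n) = flatJ n.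
Proof.
apply: flat_eq => u p v q; rewrite starE !flatE !mxE eq_sym.
by case: (p == q); rewrite ?mulr1n ?mulr0n !mxE ?bar0 // io_bar -{1}J_sym mxE.
Qed.

Lemma star_flatJ' n : star G (flatJ' n) = flatJ' n.
Proof.
apply: flat_eq => u p v q; rewrite starE !flatE !mxE eq_sym.
by case: (p == q); rewrite ?mulr1n ?mulr0n !mxE ?bar0 // io_bar -{1}J'_sym mxE.
Qed.

Lemma star_transfer n (a : 'M[S]_n) :
  star G (transfer a) = flatJ n *m transfer (star G a) *m flatJ' n.
Proof.
rewrite -!flatM; apply: flat_eq => u p v q; rewrite starE !flatE.
have -> : (J^io%:M *m map_mx subst (star G a) *m J'^io%:M) p q =
    J^io *m subst (bar G (a q p)) *m J'^io.
  by rewrite mul_scalar_mx -diag_const_mx mul_mx_diag !mxE.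
by rewrite -star_subst starE [map_mx _ _ _ _]mxE.
Qed.

Lemma flatJ_entry n (c : 'M[S]_n) u p v q :
  (flatJ n *m transfer c) (mxtens_index (u, p)) (mxtens_index (v, q)) = (J^io *m subst (c p q)) u v.
Proof.
rewrite -flatM flatE; congr (fun M : 'M_m.+1 => M u v).
by rewrite mul_scalar_mx !mxE.
Qed.

Lemma entry_flatJ' n (c : 'M[S]_n) u p v q :
  (transfer c *m flatJ' n) (mxtens_index (u, p)) (mxtens_index (v, q)) = (subst (c p q) *m J'^io) u v.
Proof.
rewrite -flatM flatE; congr (fun M : 'M_m.+1 => M u v).
by rewrite -diag_const_mx mul_mx_diag !mxE.
Qed.

(** The conjugation by [flatJ] in [star_transfer] is absorbed by the factor [flatJ], which leaves
    the sign rule of [c]. Diagonal entries are combinations, with coefficients from [Z], of entries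
    of [subst (c p p)]. *)
Lemma Lam_hermitian_flatJ n (c : 'M[S]_n) :
  Lam_hermitian G c -> Lam_hermitian G (flatJ n *m transfer c).
Proof.
move=> [hc hd]; split.
  rewrite starM star_transfer star_flatJ -!mulmxA flatJ'J mulmx1.
  by rewrite {1}hc transferNlam mulmxN mulmxZlam.
move=> k; rewrite -[k]mxtens_unindexK; case: (mxtens_unindex k) => u p.
rewrite flatJ_entry mxE; apply: Lam_sum => w _; rewrite mxE.
exact/io_Lam/subst_Lam/hd.
Qed.

Lemma Lam_hermitian_flatJ' n (c : 'M[S]_n) :
  Lam_hermitian G c -> Lam_hermitian G (transfer c *m flatJ' n).
Proof.
move=> [hc hd]; split.
  rewrite starM star_transfer star_flatJ' !mulmxA flatJ'J mul1mx.
  by rewrite {1}hc transferNlam mulNmx -scalemxAl.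
move=> k; rewrite -[k]mxtens_unindexK; case: (mxtens_unindex k) => u p.
rewrite entry_flatJ' mxE; apply: Lam_sum => w _; rewrite mxE -io_comm.
exact/io_Lam/subst_Lam/hd.
Qed.

Lemma transfer_elementary n (e : 'M[S]_n) : elementary e -> elementary (transfer e).
Proof.
apply: (generated_map (f := @transfer n)) => [|a b|_ [i [j [x [ij ->]]]]].
- exact: transfer1.
- exact: transferM.
(* Apart from the identity, only entries with second row index [i] and second column index [j] can
   be nonzero, and these indices differ. *)
rewrite transferD transfer1; apply: (elementary_support (p := fun k => (mxtens_unindex k).2 == i)).
move=> k l; have [ki|ki] /= := eqVneq (mxtens_unindex k).2 i; last first.
  by rewrite mxE [map_mx _ _ _ _]mxE !mxE (negPf ki) mulr0 rmorph0 mxE eqxx.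
have [li|//] := eqVneq (mxtens_unindex l).2 i.
by rewrite mxE [map_mx _ _ _ _]mxE !mxE li (negPf ij) andbF mulr0 rmorph0 mxE eqxx.
Qed.

(** The blockwise transfer of [s], conjugated by the block diagonal matrix with blocks $1$ and
    [flatJ n]. This carries the form twisted by [J] back to the standard hyperbolic form. *)
Definition transferQ n (s : 'M[S]_(n + n)) : 'M[S]_(m.+1 * n + m.+1 * n) :=
  block_mx (transfer (ulsubmx s)) (transfer (ursubmx s) *m flatJ' n)
           (flatJ n *m transfer (dlsubmx s)) (flatJ n *m transfer (drsubmx s) *m flatJ' n).

Lemma transferQ_block n (a b c d : 'M[S]_n) : transferQ (block_mx a b c d) =
  block_mx (transfer a) (transfer b *m flatJ' n)
    (flatJ n *m transfer c) (flatJ n *m transfer d *m flatJ' n).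
Proof. by rewrite /transferQ !(block_mxKul, block_mxKur, block_mxKdl, block_mxKdr). Qed.

Lemma transferQM n (s t : 'M[S]_(n + n)) : transferQ (s *m t) = transferQ s *m transferQ t.
Proof.
rewrite -[s]submxK -[t]submxK mulmx_block !transferQ_block mulmx_block !transferD !transferM.
have K q (x : 'M_(q, _)) : x *m flatJ' n *m flatJ n = x.
  by rewrite -mulmxA flatJ'J mulmx1.
by rewrite !mulmxDr !mulmxDl !mulmxA !K.
Qed.

Lemma transferQ_EQ n (s : 'M[S]_(n + n)) : EQ G s -> EQ G (transferQ s).
Proof.
apply: (generated_map (f := @transferQ n)) => [|a b|_ [e e' he [h1 h2]|b hb|c hc]].
- rewrite [X in transferQ X]scalar_mx_block transferQ_block transfer1 !transfer0 mulmx1 flatJJ'.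
  by rewrite mul0mx mulmx0 -scalar_mx_block.
- exact: transferQM.
- apply: generated_in; rewrite transferQ_block !transfer0 mul0mx mulmx0; apply: EQ_diag.
    exact: transfer_elementary.
  rewrite star_transfer; split; rewrite -!mulmxA (mulmxA (flatJ' n)) flatJ'J mul1mx
    (mulmxA (transfer _)) -transferM ?h1 ?h2 transfer1 mul1mx; exact: flatJJ'.
- apply: generated_in; rewrite transferQ_block !transfer0 transfer1 mulmx0 mulmx1 flatJJ'.
  apply/EQ_upper/Lambar_hermitianE.
  rewrite starM star_transfer star_flatJ' !mulmxA flatJ'J mul1mx.
  exact/Lam_hermitian_flatJ'/Lambar_hermitianE.
- apply: generated_in; rewrite transferQ_block !transfer0 transfer1 mul0mx mulmx1 flatJJ'.
  exact/EQ_lower/Lam_hermitian_flatJ.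
Qed.

Lemma transferQ_hyp n (a a' : 'M[S]_n) :
  transferQ (hyp G a a') = hyp G (transfer a) (transfer a').
Proof. by rewrite transferQ_block !transfer0 mul0mx mulmx0 /hyp star_transfer. Qed.

End Transfer.

(** * Companion matrices and their Hankel forms *)

Section Companion.
Variables (Z : comNzRingType) (m : nat) (b : nat -> Z).

Definition shift : 'M[Z]_m.+1 := \matrix_(u, v) (val u == v.+1)%:R.
Definition top_row : 'M[Z]_m.+1 := \matrix_(u, v) ((u == 0)%:R * b v).
(** With this convention $\det(1+tP)=1+\sum_i(-1)^ib_it^{i+1}$, which explains the signs met
    later. *)
Definition companion : 'M[Z]_m.+1 := shift + top_row.

Let c l : Z := if l is l'.+1 then - b l' else 1.

(* Gram matrix of the symmetric form that makes the companion matrix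
   self-adjoint *)
Definition hankel : 'M[Z]_m.+1 :=
  \matrix_(u, v) if (u + v < m)%N then 0 else c (u + v - m).

Lemma hankel_sym : hankel^T = hankel.
Proof. by apply/matrixP => u v; rewrite !mxE addnC. Qed.

Lemma shiftX i u v : (shift ^+ i) u v = (val u == v + i)%N%:R.
Proof.
elim: i u v => [|i IH] u v; first by rewrite expr0 !mxE addn0.
rewrite exprSr mxE; have [vm|mv] := ltnP v.+1 m.+1.
  rewrite (bigD1 (Ordinal vm)) //= big1 ?addr0.
    by rewrite IH mxE eqxx mulr1 /= addSnnS.
  by move=> w; rewrite mxE -val_eqE /= => /negPf->; rewrite mulr0.
rewrite big1 => [|w _].
  rewrite ltn_eqF // (leq_trans (ltn_ord u)) // addnS ltnS.
  by rewrite -ltnS (leq_trans mv) // ltnS leq_addr.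
by rewrite mxE ltn_eqF ?mulr0 // (leq_trans (ltn_ord w)).
Qed.

Lemma shift_nilpotent : shift ^+ m.+1 = 0.
Proof.
apply/matrixP => u v; rewrite shiftX mxE ltn_eqF //.
by rewrite (leq_trans (ltn_ord u)) // leq_addl.
Qed.

(** As [hankel] is symmetric, it is enough that the product is. In the first [m] rows and columns
    its entries depend on $u+v$ only; in the last row $c_{v+1}=-b_v$ cancels the contribution of the
    top row, matching the zeros of the last column. *)
Lemma hankelP : hankel *m companion = companion^T *m hankel.
Proof.
suff h : (hankel *m companion)^T = hankel *m companion by rewrite -h trmx_mul hankel_sym.
have E (u v : 'I_m.+1) : (hankel *m companion) u v =
    (if (v < m)%N then if (u + v.+1 < m)%N then 0 else c (u + v.+1 - m) else 0)
    + (u == m :> nat)%:R * b v.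
  rewrite mulmxDr mxE; congr (_ + _); last first.
    rewrite mxE (bigD1 ord0) //= big1 ?addr0 => [|w w0]; last first.
      by rewrite !mxE (negPf w0) mul0r mulr0.
    rewrite !mxE /= addn0 mul1r; have [//|mu|->] := ltngtP u m; last by rewrite subnn.
    by have := ltn_ord u; rewrite ltnS leqNgt mu.
  rewrite mxE; case: ifP => vm.
    have vm' : (v.+1 < m.+1)%N by [].
    rewrite (bigD1 (Ordinal vm')) //= big1 ?addr0 => [|w].
      by rewrite !mxE eqxx mulr1.
    by rewrite !mxE -val_eqE /= => /negPf->; rewrite mulr0.
  rewrite big1 // => w _; rewrite !mxE ltn_eqF ?mulr0 //.
  by rewrite (leq_trans (ltn_ord w)) // ltnS leqNgt vm.
apply/matrixP => u v; rewrite mxE !E.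
have [um|um] := ltnP u m; have [vm|vm] := ltnP v m.
- by rewrite !ltn_eqF // !mul0r !addnS addnC.
- have {vm} -> : v = m :> nat by apply/eqP; rewrite eqn_leq vm -ltnS ltn_ord.
  rewrite eqxx mul1r ltn_eqF // mul0r addr0. rewrite ltnNge leq_addr /= addKn /=.
  by rewrite addNr.
- have {um} -> : u = m :> nat by apply/eqP; rewrite eqn_leq um -ltnS ltn_ord.
  rewrite eqxx mul1r ltn_eqF // mul0r addr0 ltnNge leq_addr /= addKn /=.
  by rewrite addNr.
- have -> : v = m :> nat by apply/eqP; rewrite eqn_leq vm -ltnS ltn_ord.
  by have -> : u = m :> nat by apply/eqP; rewrite eqn_leq um -ltnS ltn_ord.
Qed.

(** Reversing the rows makes the Hankel matrix upper unitriangular, hence of determinant 1, and over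
    the commutative ring [Z] the adjugate provides an inverse. *)
Lemma hankel_inverse : exists J', hankel *m J' = 1%:M /\ J' *m hankel = 1%:M.
Proof.
pose K : 'M[Z]_m.+1 := \matrix_(u, v) (rev_ord u == v)%:R.
have KE u v : (K *m hankel) u v = if (v < u)%N then 0 else c (v - u).
  rewrite mxE (bigD1 (rev_ord u)) //= big1 ?addr0 => [|w]; last first.
    by rewrite mxE eq_sym => /negPf->; rewrite mul0r.
  rewrite !mxE eqxx mul1r /= subSS.
  have um : (u <= m)%N by rewrite -ltnS.
  have -> : (m - u + v < m)%N = (v < u)%N.
    by rewrite -[X in (_ < X)%N](subnK um) ltn_add2l.
  case: ltnP => // uv; congr c.
  by rewrite -[X in (_ + _ - X)%N](subnK um) subnDl.
have detK : \det (K *m hankel) = 1.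
  rewrite -det_tr det_trig.
    by rewrite big1 // => i _; rewrite mxE KE ltnn subnn.
  by apply/is_trig_mxP => i j ij; rewrite mxE KE ij.
exists (\adj (K *m hankel) *m K).
have h : \adj (K *m hankel) *m K *m hankel = 1%:M by rewrite -mulmxA mul_adj_mx detK.
by split=> //; apply: mulmx1C.
Qed.

End Companion.

(** * Polynomial $k$-th roots up to a given order *)

Lemma exprD_first_order (A : comNzRingType) (p y : A) l :
  exists w, (p + y) ^+ l = p ^+ l + y * (p ^+ l.-1 *+ l) + y ^+ 2 * w.
Proof.
elim: l => [|l [w IH]]; first by exists 0; rewrite !expr0 mulr0n !mulr0 !addr0.
exists (p * w + (p ^+ l.-1 *+ l) + y * w); rewrite !exprS IH /=.
case: l {IH} => [|l] /=; first by rewrite !expr0 mulr0n; ring.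
by rewrite mulrS !exprS -mulrnAr; move: (p ^+ l *+ l.+1) (p ^+ l) => T q; ring.
Qed.

(** Successive approximation: if the error is $hX^{M+1}$, adding $y=-\kappa h(0)X^{M+1}$ to $g$
    changes $g^k$ by $-h(0)g^{k-1}X^{M+1}$ to first order in $y$. This removes the lowest error term
    because $g(0)=1$. *)
Lemma kth_root (Z : comNzRingType) (k : nat) (kap x : Z) M :
  k%:R * kap = 1 ->
  exists g h : {poly Z}, g`_0 = 1 /\ g ^+ k = 1 + x *: 'X + h * 'X^(M.+1).
Proof.
move=> kk; elim: M => [|M [g [h [g0 gk]]]].
  exists 1, (- x%:P); split; first by rewrite coef1.
  by rewrite expr1n -mul_polyC mulNr addrK.
pose d := kap * h`_0; pose y : {poly Z} := - (d *: 'X^(M.+1)).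
have [w yw] := exprD_first_order g y k.
have [q hq] : exists q, h - h`_0 *: g ^+ k.-1 = q * 'X.
  have : (h - h`_0 *: g ^+ k.-1)`_0 = 0.
    by rewrite coefB coefZ -[X in _ * X]/(coefp 0 _) rmorphXn /= g0 expr1n mulr1 subrr.
  elim/poly_ind: (h - _) => [|q a _]; first by exists 0; rewrite mul0r.
  by rewrite coefD coefMX coefC add0r /= => ->; exists q; rewrite addr0.
(* The second-order term $y^2w=d^2X^{2M+2}w$ leaves $d^2X^Mw$ once $X^{M+2}$ is taken out. *)
exists (g + y), (q + d ^+ 2 *: 'X^M * w); split.
  by rewrite coefD coefN coefZ coefXn mulr0 oppr0 addr0.
have hE : h = q * 'X + h`_0 *: g ^+ k.-1 by rewrite -hq subrK.
have kd : y * (g ^+ k.-1 *+ k) = - (h`_0 *: g ^+ k.-1 * 'X^(M.+1)).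
  rewrite /y -!mul_polyC -[_ *+ k]mulr_natr -polyC_natr.
  transitivity (- ((k%:R * kap)%:P * (h`_0)%:P * g ^+ k.-1 * 'X^(M.+1))).
    by rewrite /d !polyCM; move: (k%:R%:P) (kap%:P) ((h`_0)%:P) 'X^(M.+1) (g ^+ _) => a a1 a2 a3 a4; ring.
  by rewrite kk mul1r.
rewrite yw gk kd {1}hE /y -!mul_polyC rmorphXn /= !exprS.
by move: 'X (d%:P) ((h`_0)%:P) (x%:P) (g ^+ k.-1) 'X^M => X D H X1 g' XM; ring.
Qed.

(** * Scalars acting on the form parameter *)

Section Good.
Variables (R : nzRingType) (F : form_ring R).

(* the scalars along which forms over (R, Lambda) can be extended *)
Definition good_scalar : {pred R} := fun x =>
  `[< [/\ forall y, x * y = y * x, bar F x = x & forall a, Lam F a -> Lam F (x * a)] >].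

Lemma good_scalarP x : reflect
  [/\ forall y, x * y = y * x, bar F x = x & forall a, Lam F a -> Lam F (x * a)]
  (x \in good_scalar).
Proof. exact: asboolP. Qed.

Fact good_scalar_subring : subring_closed good_scalar.
Proof.
split.
- by apply/good_scalarP; split=> [y||a]; rewrite ?bar1 ?mul1r ?mulr1.
- move=> x y /good_scalarP[xc xb xL] /good_scalarP[yc yb yL].
  apply/good_scalarP; split=> [z||a ha].
  + by rewrite mulrBl mulrBr xc yc.
  + by rewrite barD barN xb yb.
  + by rewrite mulrBl; apply: LamB; [apply: xL | apply: yL].
- move=> x y /good_scalarP[xc xb xL] /good_scalarP[yc yb yL].
  apply/good_scalarP; split=> [z||a ha].
  + by rewrite -mulrA yc mulrA xc mulrA.
  + by rewrite barM xb yb xc.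
  + by rewrite -mulrA; apply/xL/yL.
Qed.

HB.instance Definition _ := GRing.isSubringClosed.Build R good_scalar good_scalar_subring.

(** Centrality makes these scalars a commutative ring, over which companion and Hankel matrices can
    be formed and determinants taken. *)
Record scalars := Scalar { scalar_val : R; _ : scalar_val \in good_scalar }.
HB.instance Definition _ := [isSub for scalar_val].
HB.instance Definition _ := [Choice of scalars by <:].
HB.instance Definition _ := [SubChoice_isSubNzRing of scalars by <:].

Fact scalars_mulrC : commutative (@GRing.mul scalars).
Proof.
move=> x y; apply: val_inj; rewrite !rmorphM /=.
by have /good_scalarP[h _ _] := valP x; apply: h.
Qed.
HB.instance Definition _ := GRing.PzRing_hasCommutativeMul.Build scalars scalars_mulrC.

End Good.

(** * Block elimination for $1+N\otimes P$ *)

Section Elimination.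
Variables (R : nzRingType) (Z : comNzRingType) (io : {rmorphism Z -> {poly R}}).
Local Notation S := {poly R}.
Hypothesis io_comm : forall z p, io z * p = p * io z.
Variables (m n : nat).
Local Notation "M ^io" := (map_mx io M) (at level 2, format "M ^io").

(** The Kronecker product before flattening: its entries are the blocks $x_{pq}Q$. *)
Definition kron (Q : 'M[Z]_m.+1) (x : 'M[S]_n) : 'M['M[S]_m.+1]_n :=
  map_mx (fun c => c *: Q^io) x.

Lemma kronE Q x p q u v : kron Q x p q u v = x p q * io (Q u v).
Proof. by rewrite [kron _ _ _ _]mxE !mxE. Qed.

Lemma kron1 : kron 1 1 = 1.
Proof.
apply/matrixP => p q; rewrite [LHS]mxE map_mx1 [in RHS]mxE mxE.
by case: (p == q); rewrite ?scale1r ?scale0r.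
Qed.

Lemma kronM Q Q' x y : kron Q x * kron Q' y = kron (Q * Q') (x * y).
Proof.
apply/matrixP => p q; rewrite [RHS]mxE [(x * y) p q]mxE [LHS]mxE scaler_suml.
apply: eq_bigr => r _; rewrite [kron _ _ _ _]mxE [kron Q' _ _ _]mxE.
rewrite -!mulmxE -scalemxAl -!mul_scalar_mx (mulmxA (Q^io)) -io_scalar_comm //.
by rewrite scalar_mxM map_mxM -!mulmxA.
Qed.

Lemma kronX Q x i : kron Q x ^+ i = kron (Q ^+ i) (x ^+ i).
Proof. by elim: i => [|i IH]; rewrite ?kron1 // !exprS IH kronM. Qed.

Lemma kronD Q Q' x : kron (Q + Q') x = kron Q x + kron Q' x.
Proof. by apply/matrixP => p q; rewrite !mxE map_mxD scalerDr. Qed.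

Lemma kronN Q x : kron (- Q) x = - kron Q x.
Proof. by apply/matrixP => p q; rewrite !mxE map_mxN scalerN. Qed.

Lemma kron0 x : kron 0 x = 0.
Proof. by apply/matrixP => p q; rewrite !mxE map_mx0 scaler0. Qed.

Variables (b : nat -> Z) (N : 'M[S]_n).
Local Notation sh := (shift Z m).
Local Notation top := (top_row m b).

Lemma top_shiftX i u v : (top * (- sh) ^+ i) u v =
  if u == 0 then \sum_(w < m.+1) b w * ((-1) ^+ i * (w == v + i :> nat)%N%:R) else 0.
Proof.
rewrite mxE; case: eqP => [->|/eqP u0]; last first.
  by rewrite big1 // => w _; rewrite mxE (negPf u0) !mul0r.
apply: eq_bigr => w _; rewrite mxE eqxx mul1r -signr_odd mulr_sign.
have -> : (- sh) ^+ i = if odd i then - sh ^+ i else sh ^+ i.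
  by rewrite exprNn -signr_odd mulr_sign.
by case: (odd i); rewrite ?mxE shiftX.
Qed.

(** Splitting [companion] into [shift] and [top_row] gives $1+N\otimes P=(1+W)(1-w)$, with
    $w=-N\otimes\mathrm{sh}$ nilpotent and $W=(N\otimes\mathrm{top})(1-w)^{-1}$. The second factor
    is lower unitriangular. The first differs from 1 only in the top block row, and the geometric
    series for $(1-w)^{-1}$ gives its corner. *)
Lemma companion_elimination : exists U U' L L' : 'M[S]_(m.+1 * n),
  [/\ elementary U, elementary L, inverse_mx U U', inverse_mx L L' &
   1%:M + flat (kron (companion m b) N) =
   U *m dsum (1 + \sum_(i < m.+1) io ((-1) ^+ i * b i) *: N ^+ i.+1) 1%:M *m L].
Proof.
pose w := kron (- sh) N; pose v := \sum_(i < m.+1) w ^+ i.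
have w0 : w ^+ m.+1 = 0.
  by rewrite kronX exprNn shift_nilpotent mulr0 kron0.
have [wv vw] := nilpotent_inverse w0.
pose W := kron top N * v.
have E : 1 + kron (companion m b) N = (1 + W) * (1 - w).
  rewrite mulrDl mul1r /W -mulrA vw mulr1 /w kronN opprK -addrA; congr (_ + _).
  exact: kronD.
have WE p q u s : W p q u s =
    \sum_(i < m.+1) (N ^+ i.+1) p q * io ((top * (- sh) ^+ i) u s).
  rewrite /W mulr_sumr summxE summxE; apply: eq_bigr => i _.
  by rewrite kronX kronM -exprS kronE.
have W_top p q u s : u != 0 -> W p q u s = 0.
  move=> u0; rewrite WE big1 // => i _.
  by rewrite top_shiftX (negPf u0) rmorph0 mulr0.
pose FW : 'M[S]_(n + m * n) := flat W.
have dFW : (dlsubmx FW = 0) * (drsubmx FW = 0).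
  by split; apply/matrixP => i j; rewrite 3!mxE W_top ?mxtens_unindex_rshift // mxE.
have uFW : 1%:M + ulsubmx FW = 1 + \sum_(i < m.+1) io ((-1) ^+ i * b i) *: N ^+ i.+1.
  congr (_ + _); apply/matrixP => p q; rewrite 3!mxE !mxtens_unindex_lshift WE summxE.
  apply: eq_bigr => i _; rewrite [RHS]mxE io_comm; congr (_ * io _).
  rewrite top_shiftX eqxx (bigD1 i) //= big1 ?addr0.
    by rewrite add0n eqxx mulr1 mulrC.
  by move=> l; rewrite -val_eqE add0n => /negPf->; rewrite !mulr0.
pose U : 'M[S]_(n + m * n) := block_mx 1%:M (ursubmx FW) 0 1%:M.
pose U' : 'M[S]_(n + m * n) := block_mx 1%:M (- ursubmx FW) 0 1%:M.
exists U, U', (flat (1 - w)), (flat v); split.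
- exact: elementary_ublock.
- rewrite flatD flat1 /w kronN opprK.
  apply: (@elementary_strict _ (m.+1 * n) (fun k => (mxtens_unindex k).1)) => i j.
  rewrite mxE kronE mxE; move: (mxtens_unindex i) (mxtens_unindex j) => k l /=.
  have [->|_] := eqVneq (nat_of_ord k.1) l.1.+1.
    by rewrite ltnSn.
  by rewrite rmorph0 mulr0 eqxx.
- by split; rewrite mulmx_block !(mulmx0, mul0mx, mulmx1, mul1mx, addr0, add0r)
    ?addNr ?subrr -scalar_mx_block.
- by split; rewrite -flatM mulmxE ?wv ?vw flat1.
have UE : 1%:M + FW = U *m dsum (1%:M + ulsubmx FW) 1%:M.
  rewrite -[FW in LHS]submxK !dFW [1%:M in LHS]scalar_mx_block add_block_mx.
  by rewrite mulmx_block !(mulmx0, mul0mx, mulmx1, mul1mx, addr0, add0r).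
rewrite -flat1 -flatD [1%:M + _]E -mulmxE flatM flatD flat1; congr (_ *m _).
by rewrite -uFW; exact: UE.
Qed.

End Elimination.

(** * The scalars $1/k$ and $X$ *)

(** An inverse of the integer $k$ is central and self-adjoint because $k$ is; for $a\in\Lambda$
    write $xa=\overline x(ka)x$ and use the closure of $\Lambda$ under conjugation. *)
Lemma good_scalar_invn (R : nzRingType) (F : form_ring R) k x :
  x *+ k = 1 -> x \in good_scalar F.
Proof.
move=> xk; have xkM y : y = (x * y) *+ k by rewrite -mulrnAl xk mul1r.
have xC y : x * y = y * x by rewrite [in RHS](xkM y) mulrnAl -mulrnAr xk mulr1.
have barx : bar F x = x.
  have bxk : bar F x *+ k = 1.
    have bMn j : bar F x *+ j = bar F (x *+ j).
      by elim: j => [|j IH]; rewrite ?mulr0n ?bar0 // !mulrS IH barD.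
    by rewrite bMn xk bar1.
  by rewrite -[LHS]mulr1 -xk mulrnAr -mulrnAl bxk mul1r.
apply/good_scalarP; split=> // a ha.
have -> : x * a = bar F x * (a *+ k) * x.
  by rewrite barx -!mulrA mulrnAl -(xC a) mulrnAr -(mulrnAl x) xk mul1r.
apply: Lam_conj; elim: (k) => [|j IH]; first by rewrite mulr0n; apply: Lam0.
by rewrite mulrS; apply: LamD.
Qed.

Lemma good_scalarX (R : nzRingType) (F : form_ring R) :
  'X \in good_scalar (poly_form_ring F).
Proof.
apply/good_scalarP; split=> [y||a ha i]; first by rewrite commr_polyX.
  exact: bar_polyX.
by rewrite -commr_polyX coefMX; case: eqP => // _; apply: Lam0.
Qed.

(** * Linear matrices $1+NX$ *)

Section Linear.
Variables (R : nzRingType) (F : form_ring R).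
Local Notation S := {poly R}.
Local Notation G := (poly_form_ring F).

Definition linear_mx n (N : 'M[R]_n) : 'M[S]_n := 1%:M + map_mx (fun c => c%:P * 'X) N.

Lemma linear_mx_nilpotent n (N : 'M[R]_n) (A' : 'M[S]_n) :
  linear_mx N *m A' = 1%:M -> exists M, N ^+ M.+1 = 0.
Proof.
move=> NA'; pose V i := map_mx (coefp i) A'.
have coefNX i p q : ((map_mx (fun c => c%:P * 'X) N *m A') p q)`_i =
    if i is j.+1 then (N *m V j) p q else 0.
  rewrite mxE coef_sum; case: i => [|i].
    by rewrite big1 // => r _; rewrite mxE -mulrA coefCM -commr_polyX coefMX mulr0.
  by rewrite mxE; apply: eq_bigr => r _; rewrite !mxE -mulrA coefCM -commr_polyX coefMX.
have coefE i p q : V i p q + ((map_mx (fun c => c%:P * 'X) N *m A') p q)`_i = (p == q)%:R *+ (i == 0)%N.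
  have := congr1 (fun M : 'M[S]_n => (M p q)`_i) NA'.
  rewrite mulmxDl mul1mx mxE coefD [in RHS]mxE => e; rewrite mxE e.
  by case: (p == q); rewrite ?coef1 ?coef0 ?mul0rn; case: (i).
have VE i : V i = (- N) ^+ i.
  elim: i => [|i IH].
    apply/matrixP => p q; have := coefE 0 p q; rewrite coefNX addr0 => ->.
    by rewrite expr0 mulr1n mxE.
  apply/matrixP => p q; have := coefE i.+1 p q; rewrite coefNX mulr0n => /eqP.
  by rewrite addr_eq0 => /eqP->; rewrite exprS mulNr -IH [RHS]mxE.
pose M := \max_p \max_q size (A' p q).
exists M; rewrite -[N]opprK exprNn -VE.
suff -> : V M.+1 = 0 by rewrite mulr0.
apply/matrixP => p q; rewrite !mxE /= nth_default //; apply: leqW.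
by apply: leq_trans (leq_bigmax p); apply: (leq_bigmax (F := fun q => size (A' p q))).
Qed.

Lemma linear_no_torsion k (kap : R) n (N : 'M[R]_n) (A' : 'M[S]_n) :
  (0 < k)%N -> kap *+ k = 1 -> inverse_mx (linear_mx N) A' ->
  EQ G (hyp G (linear_mx N) A' ^+ k) ->
  EQst G (stable (hyp G (linear_mx N) A')).
Proof.
case: n N A' => [|n] N A' k0 kapk AV hk.
  rewrite [hyp _ _ _](_ : _ = 1%:M); first exact: EQst1.
  by apply/matrixP => -[].
pose Z := scalars G; pose io : {rmorphism Z -> S} := val.
have io_comm z p : io z * p = p * io z by have /good_scalarP[h _ _] := valP z.
have io_bar z : bar G (io z) = io z by have /good_scalarP[_ h _] := valP z.
have io_Lam z p : Lam G p -> Lam G (io z * p) by have /good_scalarP[_ _ h] := valP z; apply: h.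
have kapP : kap%:P *+ k = 1 :> S by rewrite -polyCMn kapk.
(* The scalar ring contains $1/k$ and the indeterminate $X$ of [S]; polynomials over it have a
   further variable $t$. *)
pose kz : Z := Scalar (good_scalar_invn G kapP); pose xz : Z := Scalar (good_scalarX F).
have kkz : k%:R * kz = 1.
  by apply: val_inj; rewrite rmorphM rmorph_nat rmorph1 /= mulr_natl.
have [M NM] := linear_mx_nilpotent (proj1 AV).
(* Here $g$ approximates $(1+Xt)^{1/k}$ modulo $t^{M+1}$, so at $t=N$, where $N^{M+1}=0$, it gives
   an exact root. *)
have [g [h [g0 gk]]] := kth_root xz M kkz.
(* The sign cancels the one in [companion_elimination], whose corner becomes $g(N)$; the choice of
   [m] takes in all coefficients of $g$. *)
pose m := size g; pose b i := (-1) ^+ i * g`_i.+1.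
have bE i : (-1) ^+ i * b i = g`_i.+1 by rewrite /b signrMK.
pose NS : 'M[S]_n.+1 := map_mx polyC N.
have NS_comm : commr_rmorph (scalar_mx \o io : {rmorphism Z -> 'M[S]_n.+1}) NS.
  move=> z; rewrite /GRing.comm /= -!mulmxE mul_scalar_mx -diag_const_mx mul_mx_diag.
  by apply/matrixP => p q; rewrite !mxE io_comm.
pose ev : {rmorphism {poly Z} -> 'M[S]_n.+1} := horner_morph NS_comm.
have evX : ev 'X = NS by exact: horner_morphX.
have evC z : ev z%:P = (io z)%:M by exact: horner_morphC.
have evg : ev g = 1 + \sum_(i < m.+1) io ((-1) ^+ i * b i) *: NS ^+ i.+1.
  rewrite (_ : ev g = (map_poly (scalar_mx \o io) g).[NS]) // (@horner_coef_wide _ m.+2); last first.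
    by rewrite (leq_trans (size_poly _ _)) // /m ltnW.
  rewrite big_ord_recl; congr (_ + _); first by rewrite coef_map g0 /= rmorph1 mul1r.
  by apply: eq_bigr => i _; rewrite coef_map bE lift0 -mulmxE mul_scalar_mx.
have evgk : ev g ^+ k = linear_mx N.
  have NSX i : NS ^+ i = map_mx polyC (N ^+ i).
    elim: i => [|i IH]; first by rewrite map_mx1.
    by rewrite !exprS IH -!mulmxE map_mxM.
  have NSM : NS ^+ M.+1 = 0 by rewrite NSX NM map_mx0.
  rewrite -rmorphXn gk !rmorphD rmorph1 -mul_polyC !rmorphM rmorphXn evX evC NSM.
  rewrite mulr0 addr0 -mulmxE mul_scalar_mx; congr (_ + _).
  by apply/matrixP => p q; rewrite !mxE commr_polyX.
(* A root of positive order of an invertible matrix is invertible. *)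
have [B' BV] : exists B', inverse_mx (ev g) B'.
  by case: k k0 evgk {hk kapk kapP kkz gk kz} => // k _ e; apply: inverse_mx_expr AV e.
have [J' [JJ' J'J]] := hankel_inverse m b.
pose T := @transfer R Z io io_comm m (companion m b).
have TX a j : T n.+1 a ^+ j = T n.+1 (a ^+ j).
  elim: j => [|j IH]; first by rewrite !expr0 [RHS]transfer1.
  by rewrite !exprS IH -!mulmxE -transferM.
have hkT : EQ G (hyp G (T _ (linear_mx N)) (T _ A') ^+ k).
  rewrite hypX !TX.
  (* The relation [hk] holds at the actual size [n.+1], so the transfer applies to it directly. *)
  have := transferQ_EQ io_comm io_bar io_Lam (hankel_sym m b) JJ' J'J (hankelP m b) hk.
  by rewrite hypX (transferQ_hyp io_comm io_bar JJ' J'J (hankelP m b)).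
have [U [U' [L [L' [UE LE UV LV TE]]]]] := companion_elimination io_comm m b NS.
have TAE : T _ (linear_mx N) = U *m dsum (ev g) 1%:M *m L.
  rewrite evg -TE /T transferD transfer1; congr (_ + flat _).
  apply/matrixP => p q; rewrite !mxE rmorphM /= horner_morphC horner_morphX.
  by rewrite -mulmxE mul_scalar_mx.
have BV1 : inverse_mx (dsum (ev g) (1%:M : 'M_(m * n.+1))) (dsum B' 1%:M).
  by apply: inverse_dsum => //; apply: inverse_mx1.
have TV : inverse_mx (T _ (linear_mx N)) (T _ A').
  by case: AV => e1 e2; split; rewrite -transferM ?e1 ?e2 transfer1.
have TA'E : T _ A' = L' *m (dsum B' 1%:M *m U').
  have [_ e1] := inverse_mxM (inverse_mxM UV BV1) LV.
  by have [e2 _] := TV; rewrite -TAE in e1; apply: inverse_mx_uniq e2 e1.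
have hypE : hyp G (T _ (linear_mx N)) (T _ A') =
    hyp G U U' *m hyp G (dsum (ev g) 1%:M) (dsum B' 1%:M) *m hyp G L L'.
  by rewrite !hypM TAE TA'E.
have UQ := EQst_EQ (EQ_hyp G UE UV); have LQ := EQst_EQ (EQ_hyp G LE LV).
(* Removing the elementary factors and the identity summand leaves $H(g(N))^k$, which [evgk]
   identifies with $H(1+NX)$. *)
have := EQst_peel BV1 (inverse_hyp G UV) (inverse_hyp G LV) UQ LQ hypE (EQst_EQ hkT).
rewrite -embed_hyp -embedX stable_embed hypX evgk.
suff -> : B' ^+ k = A' by [].
have [e _] := AV; have [_ e'] := inverse_mxX k BV.
by rewrite evgk in e'; rewrite (inverse_mx_uniq e e').
Qed.

End Linear.

(** * Higman linearization *)

Section Higman.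
Variables (R : nzRingType) (F : form_ring R) (k : nat) (kap : R).
Hypotheses (k_gt0 : (0 < k)%N) (kapk : kap *+ k = 1).
Local Notation S := {poly R}.
Local Notation G := (poly_form_ring F).

Lemma mulmx_Xscalar n (a : 'M[S]_n) p q : (a *m 'X%:M) p q = a p q * 'X.
Proof. by rewrite -diag_const_mx mul_mx_diag !mxE. Qed.

Lemma dsum_linear_mx d n (N : 'M[R]_n) :
  dsum (linear_mx N) (1%:M : 'M_d) = linear_mx (dsum N 0).
Proof.
rewrite /linear_mx /dsum map_block_mx [1%:M in RHS]scalar_mx_block add_block_mx.
by congr block_mx; apply/matrixP => p q; rewrite !mxE ?polyC0 ?mul0r ?addr0.
Qed.

(** A stably elementary matrix becomes elementary after some number [d] of stabilizations, and these
    keep the matrix linear, with $N$ replaced by $N\oplus0$. *)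
Lemma linear_stable_no_torsion n (N : 'M[R]_n) (A' : 'M[S]_n) :
  inverse_mx (linear_mx N) A' ->
  EQst G (stable (hyp G (linear_mx N) A' ^+ k)) ->
  EQst G (stable (hyp G (linear_mx N) A')).
Proof.
move=> AV /EQstP[d /(_ d (leqnn d))]; rewrite embedX embed_hyp dsum_linear_mx => h.
rewrite -(stable_embed d) embed_hyp dsum_linear_mx.
apply: (linear_no_torsion k_gt0 kapk _ h); rewrite -dsum_linear_mx.
exact: inverse_dsum (inverse_mx1 _ _).
Qed.

(* Higman's trick: one step of stabilization lowers the degree by one *)
Lemma higman_no_torsion d n (A A' : 'M[S]_n) :
  inverse_mx A A' -> map_mx (coefp 0) A = 1%:M ->
  (forall p q, (size (A p q) <= d.+2)%N) ->
  EQst G (stable (hyp G A A' ^+ k)) -> EQst G (stable (hyp G A A')).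
Proof.
elim: d n A A' => [|d IH] n A A' AV A0 Ad hk.
  have AE : A = linear_mx (map_mx (coefp 1) A).
    apply/matrixP => p q; have := congr1 (fun M : 'M_n => M p q) A0; rewrite !mxE /= => A0pq.
    apply/polyP => i; rewrite coefD coefMX coefC.
    case: i => [|[|i]] /=; first by rewrite A0pq addr0; case: (p == q); rewrite ?coef1 ?coef0.
      by case: (p == q); rewrite ?coef1 ?coef0 add0r.
    by rewrite nth_default ?addr0 // ?(leq_trans (Ad p q)) //; case: (p == q); rewrite ?coef1 ?coef0.
  by rewrite AE in AV hk *; apply: linear_stable_no_torsion.
(* [Q *m X] is the part of [A] of top degree $d+2$. The factor $X^{d+1}$ of [Q] vanishes at 0, so
   [B] again has constant term 1. *)
pose Q : 'M[S]_n := map_mx (fun a : S => a`_(d.+2) *: 'X^(d.+1)) A.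
pose X : 'M[S]_n := 'X%:M.
(* [B] is $A\oplus1$ multiplied by elementary matrices on both sides; its corner has lost the top
   degree, and the other blocks have degree at most $d+1$. *)
pose B : 'M[S]_(n + n) := block_mx (A - Q *m X) Q (- X) 1%:M.
have BulE p q : (A - Q *m X) p q = A p q - Q p q * 'X by rewrite 2!mxE mulmx_Xscalar.
pose U (C : 'M[S]_n) : 'M[S]_(n + n) := block_mx 1%:M C 0 1%:M.
pose V (C : 'M[S]_n) : 'M[S]_(n + n) := block_mx 1%:M 0 C 1%:M.
have UV C : inverse_mx (U C) (U (- C)) by apply: inverse_ublock.
have VV C : inverse_mx (V C) (V (- C)) by apply: inverse_lblock.
have UE C : elementary (U C) by apply: elementary_ublock.
have VE C : elementary (V C) by apply: elementary_lblock.
have BE : B = U Q *m dsum A 1%:M *m V (- X).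
  rewrite /B /U /V /dsum !mulmx_block !(mulmx0, mul0mx, mulmx1, mul1mx, addr0, add0r).
  by rewrite mulmxN.
pose B' : 'M[S]_(n + n) := V X *m dsum A' 1%:M *m U (- Q).
have AV1 : inverse_mx (dsum A (1%:M : 'M_n)) (dsum A' 1%:M).
  by apply: inverse_dsum (inverse_mx1 _ _).
have BV : inverse_mx B B'.
  rewrite BE /B' -[V X *m _ *m _]mulmxA; apply: inverse_mxM; last exact: inverse_mx_sym.
  exact: inverse_mxM.
have AE : dsum A 1%:M = U (- Q) *m B *m V X.
  have [_ u] := UV Q; have [_ v] := VV X.
  by rewrite BE -!mulmxA v mulmx1 mulmxA u mul1mx.
have A'E : dsum A' 1%:M = V (- X) *m (B' *m U Q).
  have [_ u] := UV Q; have [_ v] := VV X.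
  by rewrite /B' -!mulmxA u mulmx1 mulmxA v mul1mx.
have hypE : hyp G (dsum A 1%:M) (dsum A' 1%:M) =
    hyp G (U (- Q)) (U Q) *m hyp G B B' *m hyp G (V X) (V (- X)).
  by rewrite !hypM -AE -A'E.
have UV' : inverse_mx (U (- Q)) (U Q) by apply: inverse_mx_sym.
have UQ := EQst_EQ (EQ_hyp G (UE (- Q)) UV').
have VQ := EQst_EQ (EQ_hyp G (VE X) (VV X)).
rewrite -(stable_embed n) embed_hyp hypE; apply: EQstM => //; apply: EQstM => //.
apply: IH => //.
- rewrite /B map_block_mx map_mx1 scalar_mx_block; congr block_mx.
  + rewrite -[RHS]A0; apply/matrixP => p q.
    by rewrite mxE BulE !mxE /= coefB coefMX subr0.
  + by apply/matrixP => p q; rewrite !mxE /= coefZ coefXn mulr0.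
  + apply/matrixP => p q; rewrite !mxE /= coefN.
    by case: (p == q); rewrite ?mulr1n ?coefX ?mulr0n ?coef0 oppr0.
- move=> p q; rewrite -(splitK p) -(splitK q); case: (split p) => {}p; case: (split q) => {}q /=.
  + rewrite block_mxEul BulE mxE.
    apply/leq_sizeP => i; rewrite leq_eqVlt => /predU1P[<-|di].
      by rewrite coefB coefMX /= coefZ coefXn eqxx mulr1 subrr.
    rewrite coefB coefMX coefZ coefXn nth_default ?(leq_trans (Ad p q)) //.
    by case: i di => // i di /=; rewrite gtn_eqF // mulr0 subr0.
  + rewrite block_mxEur mxE (leq_trans (size_scale_leq _ _)) // size_polyXn.
    by [].
  + rewrite block_mxEdl !mxE size_polyN; case: (p == q); rewrite ?mulr1n ?mulr0n ?size_polyX //.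
    by rewrite size_poly0.
  + by rewrite block_mxEdr mxE; case: (p == q); rewrite ?size_poly1 ?size_poly0.
- apply: (EQst_peel BV (inverse_hyp G UV') (inverse_hyp G (VV X)) UQ VQ hypE).
  by rewrite -embed_hyp -embedX stable_embed.
Qed.

End Higman.

(** * From hyperbolic matrices to the class of $\alpha$ *)

Lemma hyp_no_torsion (R : nzRingType) (F : form_ring R) k (k_gt0 : (0 < k)%N)
  (kR : [set x *+ k | x in [set: R]] = [set: R]) n (A A' : 'M[{poly R}]_n) :
  inverse_mx A A' -> map_mx (coefp 0) A = 1%:M ->
  EQst (poly_form_ring F) (stable (hyp (poly_form_ring F) A A' ^+ k)) ->
  EQst (poly_form_ring F) (stable (hyp (poly_form_ring F) A A')).
Proof.
move=> AV A0; have [kap _ kapk] : [set x *+ k | x in [set: R]] 1 by rewrite kR.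
apply: (higman_no_torsion k_gt0 kapk (d := \max_p \max_q size (A p q)) AV A0) => p q.
by do 2!apply: leqW; apply: leq_trans (leq_bigmax p); apply: (leq_bigmax (F := fun q => size (A p q))).
Qed.

Theorem theorem1p1 (R : nzRingType) (F : form_ring R)
  (k : nat) (k_gt0 : (0 < k)%N)
  (kR : [set x *+ k | x in [set: R]] = [set: R])
  (r : nat) (alpha : 'M[{poly R}]_(r + r))
  (alphaGQ : GQ (poly_form_ring F) alpha)
  (AGL : GL (ulsubmx alpha))
  (alphaNK1 : NK1GQ F (K1class (poly_form_ring F) alpha)) :
  K1exp (poly_form_ring F) (K1class (poly_form_ring F) alpha) k
    = K1one (poly_form_ring F) ->
  K1class (poly_form_ring F) alpha = K1one (poly_form_ring F).
Proof.
set G := poly_form_ring F => torsion.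
have [[beta alphaV] _ _ _] := alphaGQ.
apply: (K1class_one alphaV).
have alphaX : EQst G (stable (alpha ^+ k)) by rewrite -K1oneE -torsion; apply: K1expX.
(* Evaluation at $X=0$ followed by the inclusion of constants, so that $\alpha(0)$ can be compared
   with $\alpha$ over $R[X]$. *)
pose at0 n := fun a : 'M[{poly R}]_n => map_mx polyC (map_mx (coefp 0) a).
have at0_inv n (a a' : 'M_n) : inverse_mx a a' -> inverse_mx (at0 n a) (at0 n a').
  by move=> h; apply/inverse_map/inverse_map.
have at0M n (a b : 'M_n) : at0 n (a *m b) = at0 n a *m at0 n b by rewrite /at0 !map_mxM.
(* Membership in the kernel of $X\mapsto0$ makes $\alpha(0)$ stably elementary over $R$, hence over
   $R[X]$. *)
have alpha0 : EQst G (stable (at0 _ alpha)).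
  apply: EQst_polyC; have [_ h] := alphaNK1; rewrite -K1oneE -h.
  exists r, (map_mx (coefp 0) alpha), 1%:M; split; rewrite ?mulmx1 //; last exact: EQst1.
  exists (stable alpha); first exact: K1class_refl.
  rewrite stable_eval0E; congr stable; apply/matrixP => i j.
  by rewrite !mxE horner_coef0.
have [A' AA'] := AGL; have [b [c [hb hc alphaE]]] := GQ_factor alphaGQ AA'.
move: AA' alphaE; move: (ulsubmx alpha) => A AA' alphaE.
set L := block_mx 1%:M 0 c 1%:M in alphaE; set U := block_mx 1%:M b 0 1%:M in alphaE.
have LE : EQst G (stable L) by apply/EQst_EQ/generated_in/EQ_lower.
have UE : EQst G (stable U) by apply/EQst_EQ/generated_in/EQ_upper.
have LV := inverse_lblock c; have UV := inverse_ublock b.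
pose A0 := at0 _ A; pose A0' := at0 _ A'; have A0V : inverse_mx A0 A0' by apply: at0_inv.
(* The factorization evaluated at 0 expresses $H(A(0))$ through $\alpha(0)$ and unipotent factors,
   all stably elementary. *)
have hypA0 : EQst G (stable (hyp G A0 A0')).
  have E0 : at0 _ (hyp G A A') = hyp G A0 A0'.
    rewrite /hyp /at0 /dsum !map_block_mx !map_mx0; congr block_mx.
    apply/matrixP => i j; rewrite !mxE /=.
    by rewrite bar_polyC coef_bar.
  have [LL' L'L] := at0_inv _ _ _ LV; have [UU' U'U] := at0_inv _ _ _ UV.
  have -> : hyp G A0 A0' = at0 _ (block_mx 1%:M 0 (- c) 1%:M) *m at0 _ alpha
      *m at0 _ (block_mx 1%:M (- b) 0 1%:M).
    by rewrite alphaE !at0M E0 !mulmxA L'L mul1mx -mulmxA UU' mulmx1.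
  have at0_EQst s : EQst G (stable s) -> EQst G (stable (at0 _ s)).
    by move=> hs; apply/EQst_polyC/EQst_coef0.
  apply: EQstM; first apply: EQstM => //.
    by apply: at0_EQst; apply: EQstV LE LV.
  by apply: at0_EQst; apply: EQstV UE UV.
(* The matrix $A(X)A(0)^{-1}$ has constant term 1, as linearization requires. *)
pose A1 := A *m A0'; pose A1' := A0 *m A'.
have A1V : inverse_mx A1 A1' by apply: inverse_mxM => //; apply: inverse_mx_sym.
have hypA : hyp G A A' = hyp G A1 A1' *m hyp G A0 A0'.
  have [_ e] := A0V.
  by rewrite hypM /A1 /A1' -mulmxA e mulmx1 mulmxA e mul1mx.
have alphaE1 : alpha = L *m hyp G A1 A1' *m (hyp G A0 A0' *m U).
  by rewrite alphaE hypA !mulmxA.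
suff hypA1 : EQst G (stable (hyp G A1 A1')).
  by rewrite alphaE1; do !apply: EQstM.
apply: (hyp_no_torsion k_gt0 kR A1V).
  apply/matrixP => i j; rewrite map_mxM.
  have [e _] := inverse_map (coefp 0) AA'.
  rewrite -[RHS](congr1 (fun M : 'M_r => M i j) e); congr ((_ *m _) i j).
  by apply/matrixP => u v; rewrite !mxE /= coefC.
(* Stripping the outer factors from $\alpha^k$ leaves the $k$-th power of $H(A(X)A(0)^{-1})$. *)
apply: (EQst_peel A1V LV _ LE _ alphaE1 alphaX).
  exact: inverse_mxM (inverse_hyp G A0V) UV.
exact: EQstM.
Qed.
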